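(* Let $q$ be a prime number different from $2$, $G=PGL(2,\mathbb{Q}_q)$, $X$ a compact space, $\mu$ a positive Borel measure on $X$ with $\mu(X)<\tfrac12$, $\mathcal{G}^0$ the group of step functions $X\to G$, and $\mathcal{G}$ the group of bounded measurable currents, i.e. the completion of $\mathcal{G}^0$ with respect to the metric $\delta$. Then the positive definite function on $\mathcal{G}^0$ $$\xi\longmapsto\langle\Xi(\xi)\operatorname{EXP}(0),\operatorname{EXP}(0)\rangle=q^{-\frac12\int_X\|b(\xi(x))\|^2\,d\mu(x)}$$ extends by continuity to a positive definite function on $\mathcal{G}$.
   Context: $\mathcal{T}$ is the Bruhat–Tits tree of $G$: vertices are the homothety classes $[L]$ of $\mathbb{Z}_q$-lattices $L\subset\mathbb{Q}_q^2$, two distinct classes being adjacent if they have representatives with $qL\subsetneq L'\subsetneq L$; it is homogeneous of degree $q+1$; $d$ is the tree distance, $o=[\mathbb{Z}_q^2]$, $K$ the stabilizer of $o$ in $G$. The boundary $\Omega$ is the set of equivalence classes of geodesic rays (two rays being equivalent if they coincide up to a shift, from some point on), with its natural compact topology; $[v,\omega)$ is the unique ray from $v$ in the class $\omega$; $\nu$ is the unique $K$-invariant probability measure on $\Omega$. For $g\in G$ put $b(g)(\omega)=d(o,x)-d(g\cdot o,x)$, where $x$ is any vertex common to $[o,\omega)$ and $[g\cdot o,\omega)$. For distinct $\omega,\omega'$, $|\omega\wedge\omega'|$ is the number of edges common to $[o,\omega)$ and $[o,\omega')$. On complex locally constant functions on $\Omega$ modulo constants put $$\|F\|^2=\langle F,F\rangle=\frac{q^2-1}{4q}\int_\Omega\int_\Omega|F(\omega)-F(\omega')|^2q^{2|\omega\wedge\omega'|}\,d\nu(\omega)\,d\nu(\omega');$$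 then $\tfrac12\|b(g)\|^2=d(o,g\cdot o)+\frac{2q}{q^2-1}\bigl(q^{-d(o,g\cdot o)}-1\bigr)$. The Steinberg representation is $\operatorname{St}(g)F(\omega)=F(g^{-1}\omega)$ on the completion. $\mathcal{G}^0$ is the group, under pointwise multiplication, of functions $\xi:X\to G$ that are constant on each set of some finite partition of $X$ into Borel sets. Fock representation: let $H_q$ be the completion above with norm $\|v\|_q^2=\log(q)\langle v,v\rangle$, $H^X=L^2(X,\mu;H_q)$, $b^X(\xi)(x)=b(\xi(x))$, $(\operatorname{St}^X(\xi)\mathbf{v})(x)=\operatorname{St}(\xi(x))\mathbf{v}(x)$. On the symmetric Fock space $\operatorname{EXP}(H^X)$ with exponential vectors $\operatorname{EXP}(\mathbf{v})$, $\langle\operatorname{EXP}(\mathbf{u}),\operatorname{EXP}(\mathbf{v})\rangle=e^{\langle\mathbf{u},\mathbf{v}\rangle}$, $\Xi$ is the unitary representation of $\mathcal{G}^0$ given by $\Xi(\xi)\operatorname{EXP}(\mathbf{v})=e^{-\frac12\|b^X(\xi)\|^2-\langle\operatorname{St}^X(\xi)\mathbf{v},\,b^X(\xi)\rangle}\operatorname{EXP}(\operatorname{St}^X(\xi)\mathbf{v}+b^X(\xi))$. Metric: for $g_1,g_2\in G$, $$\Delta(g_1,g_2)=d(g_1\cdot o,g_2\cdot o)+\sum_{n=1}^\infty\ \sum_{v:\,d(o,v)=n}\frac{d(g_1\cdot v,g_2\cdot v)}{(q+1)^n\,[1+d(g_1\cdot v,g_2\cdot v)]},$$ a left-invariant metric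 generating the topology of $G$; for $\xi_1,\xi_2\in\mathcal{G}^0$, $\delta(\xi_1,\xi_2)=\sup_{x\in X}\Delta(\xi_1(x),\xi_2(x))$. Elements of $\mathcal{G}$ are represented by the measurable functions $F:X\to G$ that are bounded, i.e. whose image lies in finitely many cosets $g_iK_N$ for some $N$, where $K_N=\{g\in G: g\cdot v=v\ \text{whenever } d(v,o)\le N\}$; multiplication is pointwise. *)

(* Defs.v *)
From HB Require Import structures.
From mathcomp Require Import all_boot all_order all_algebra.
From mathcomp Require Import complex finmap zify.
From mathcomp Require Import all_classical all_reals all_analysis.

Set Implicit Arguments.
Unset Strict Implicit.
Unset Printing Implicit Defensive.

Import Order.TTheory GRing.Theory Num.Theory.

Local Open Scope classical_set_scope.
Local Open Scope quotient_scope.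
Local Open Scope complex_scope.
Local Open Scope ring_scope.

(* The ring of p-adic integers as the inverse limit of the rings Z / p^n,     *)
(* residues mod p^n being represented by integers in [0, p^n[.                *)

Section PadicInt.
Variables (p : nat) (p_pr : prime p).

Definition padic_coherent (x : nat -> int) :=
  forall n, (x n.+1 %% (p ^ n)%N%:Z)%Z = x n.

Record padic_int (hp : prime p) :=
  PadicInt { residue :> nat -> int ; _ : padic_coherent residue }.

Local Notation Zp := (padic_int p_pr).
Local Notation "m == n [[ k ]]" := (m = n %[mod (p ^ k)%N%:Z])%Z
  (at level 70, n at next level).

HB.instance Definition _ := gen_eqMixin Zp.
HB.instance Definition _ := gen_choiceMixin Zp.

Lemma residueS (x : Zp) n : (x n.+1 %% (p ^ n)%N%:Z)%Z = x n.
Proof. by case: x. Qed.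

Lemma residue_mod (x : Zp) n : (x n %% (p ^ n)%N%:Z)%Z = x n.
Proof. by rewrite -residueS modz_mod. Qed.

Lemma padicP (x y : Zp) : (forall n, x n == y n [[n]]) -> x = y.
Proof.
case: x y => [x hx] [y hy] /= e.
have exy : x = y.
  apply/funext => n; move: (e n).
  by rewrite -hx modz_mod -(hy n) modz_mod.
by case: _ / exy hy {e} => hy; congr PadicInt; exact: Prop_irrelevance.
Qed.

Lemma modz_expn (m : int) k n : (k <= n)%N -> (m %% (p ^ n)%N%:Z)%Z == m [[k]].
Proof.
move=> kn; rewrite [in RHS](divz_eq m (p ^ n)%N%:Z).
by rewrite -(subnK kn) expnD PoszM mulrA modzMDl.
Qed.

Definition padic_compat (f : nat -> int) := forall n, f n.+1 == f n [[n]].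

Lemma padic_compat_coherent f : padic_compat f ->
  padic_coherent (fun n => f n %% (p ^ n)%N%:Z)%Z.
Proof.
by move=> cf n; rewrite modz_expn ?leqnSn //; exact: cf.
Qed.

Lemma residue_compat (x : Zp) : padic_compat x.
Proof. by move=> n; rewrite residueS residue_mod. Qed.

Definition padic_reduce f (cf : padic_compat f) : Zp :=
  PadicInt p_pr (padic_compat_coherent cf).

Lemma padic_reduceE f (cf : padic_compat f) n : padic_reduce cf n == f n [[n]].
Proof. by rewrite /= modz_mod. Qed.

Lemma padic_cstC (m : int) : padic_compat (fun=> m). Proof. by []. Qed.

Lemma padic_addc (x y : Zp) : padic_compat (fun n => x n + y n).
Proof.
move=> n; rewrite -modzDm residueS residueS.
by rewrite -(residue_mod x) -(residue_mod y).
Qed.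

Lemma padic_oppc (x : Zp) : padic_compat (fun n => - x n).
Proof. by move=> n; rewrite -modzNm residueS. Qed.

Lemma padic_mulc (x y : Zp) : padic_compat (fun n => x n * y n).
Proof. by move=> n; rewrite -modzMm residueS residueS. Qed.

Definition padic0 : Zp := padic_reduce (padic_cstC 0).
Definition padic1 : Zp := padic_reduce (padic_cstC 1).
Definition padic_add x y : Zp := padic_reduce (padic_addc x y).
Definition padic_opp x : Zp := padic_reduce (padic_oppc x).
Definition padic_mul x y : Zp := padic_reduce (padic_mulc x y).

Lemma padic_addA : associative padic_add.
Proof.
by move=> x y z; apply: padicP => n; rewrite /= !modz_mod modzDmr modzDml addrA.
Qed.

Lemma padic_addC : commutative padic_add.
Proof. by move=> x y; apply: padicP => n; rewrite /= addrC. Qed.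

Lemma padic_add0 : left_id padic0 padic_add.
Proof. by move=> x; apply: padicP => n; rewrite /= mod0z add0r modz_mod. Qed.

Lemma padic_addN : left_inverse padic0 padic_opp padic_add.
Proof. by move=> x; apply: padicP => n; rewrite /= modzDml addNr !mod0z. Qed.

HB.instance Definition _ := GRing.isZmodule.Build Zp
  padic_addA padic_addC padic_add0 padic_addN.

Lemma padic_mulA : associative padic_mul.
Proof.
by move=> x y z; apply: padicP => n; rewrite /= !modz_mod modzMmr modzMml mulrA.
Qed.

Lemma padic_mulC : commutative padic_mul.
Proof. by move=> x y; apply: padicP => n; rewrite /= mulrC. Qed.

Lemma padic_mul1 : left_id padic1 padic_mul.
Proof. by move=> x; apply: padicP => n; rewrite /= modzMml mul1r modz_mod. Qed.

Lemma padic_mulD : left_distributive padic_mul padic_add.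
Proof.
by move=> x y z; apply: padicP => n; rewrite /= !modz_mod modzMml modzDm mulrDl.
Qed.

Lemma padic1_neq0 : padic1 != padic0.
Proof.
apply/eqP => /(congr1 (fun x : Zp => x 1)) /=.
rewrite expn1 mod0z modz_small //.
by rewrite ltz_nat prime_gt1.
Qed.

HB.instance Definition _ := GRing.Zmodule_isComNzRing.Build Zp
  padic_mulA padic_mulC padic_mul1 padic_mulD padic1_neq0.

Definition padic_unit : {pred Zp} := fun x => `[< exists y : Zp, y * x = 1 >].
Definition padic_inv (x : Zp) : Zp :=
  if pselect (exists y : Zp, y * x = 1) is left h then projT1 (cid h) else x.

Lemma padic_mulVx : {in padic_unit, left_inverse 1 padic_inv *%R}.
Proof.
move=> x /asboolP ux; rewrite /padic_inv; case: pselect => // h.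
by case: cid.
Qed.

Lemma padic_unitP (x y : Zp) : y * x = 1 -> padic_unit x.
Proof. by move=> yx; apply/asboolP; exists y. Qed.

Lemma padic_invr_out : {in [predC padic_unit], padic_inv =1 id}.
Proof.
by move=> x /asboolP ux; rewrite /padic_inv; case: pselect => // h.
Qed.

HB.instance Definition _ := GRing.ComNzRing_hasMulInverse.Build Zp
  padic_mulVx padic_unitP padic_invr_out.

Lemma residue_eq0 (x : Zp) m n : (m <= n)%N ->
  (x m == 0) = ((p ^ m)%N %| `|x n|)%N.
Proof.
move=> mn; have xmn : x n == x m [[m]].
  rewrite -(subnKC mn); elim: (n - m)%N => [|k IH]; first by rewrite addn0.
  by rewrite addnS -IH -[in RHS]residueS modz_expn // leq_addr.
rewrite -residue_mod -xmn; apply/eqP/idP => [/dvdz_mod0P//|dvd].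
exact/dvdz_mod0P.
Qed.

Lemma padic_neq0 (x : Zp) : x != 0 -> exists n, x n != 0.
Proof.
move=> x0; apply: contrapT => /forallNP xn0; case/eqP: x0.
by apply: padicP => n; move/negP/negPn/eqP: (xn0 n) => ->; rewrite /= modz_mod.
Qed.

Lemma padic_idomain : GRing.integral_domain_axiom Zp.
Proof.
move=> x y xy0; case: eqVneq => //= x0; apply/negPn/negP => y0.
have [a xa] := padic_neq0 x0; have [b yb] := padic_neq0 y0.
have : ((x * y) (a + b)%N == x (a + b)%N * y (a + b)%N [[a + b]]).
  exact: padic_reduceE.
rewrite xy0 [X in (X %% _)%Z]mod0z mod0z => /esym/dvdz_mod0P.
rewrite dvdzE abszM /=; move: xa yb.
rewrite (residue_eq0 x (leq_addr b a)) (residue_eq0 y (leq_addl a b)).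
move: `|x _|%N `|y _|%N => m n.
have [->|m0] := posnP m; first by rewrite dvdn0.
have [->|n0] := posnP n; first by rewrite dvdn0.
rewrite !pfactor_dvdn ?muln_gt0 ?m0 // lognM // -?ltnNge => la lb.
by apply/negP; rewrite -ltnNge; move: la lb; lia.
Qed.

HB.instance Definition _ := GRing.ComUnitRing_isIntegral.Build Zp padic_idomain.

End PadicInt.

Section PGL2.
Variable F : fieldType.

Record GL2 := MkGL2 { GL2val :> 'M[F]_2 ; _ : GL2val \in unitmx }.
HB.instance Definition _ := [isSub for GL2val].
HB.instance Definition _ := [Choice of GL2 by <:].

Lemma GL2_unit (A : GL2) : (A : 'M[F]_2) \in unitmx. Proof. by case: A. Qed.

Lemma GL2_mul_unit (A B : GL2) : (A : 'M[F]_2) *m B \in unitmx.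
Proof. by rewrite unitmx_mul !GL2_unit. Qed.

Lemma GL2_inv_unit (A : GL2) : invmx A \in unitmx.
Proof. by rewrite unitmx_inv GL2_unit. Qed.

Definition GL2_one := MkGL2 (unitmx1 F 2).
Definition GL2_mul A B := MkGL2 (GL2_mul_unit A B).
Definition GL2_inv A := MkGL2 (GL2_inv_unit A).

Definition proportional (A B : GL2) : bool :=
  `[< exists2 c : F, c != 0 & (A : 'M[F]_2) = c *: (B : 'M[F]_2) >].

Lemma proportional_refl : reflexive proportional.
Proof. by move=> A; apply/asboolP; exists 1; rewrite ?oner_neq0 ?scale1r. Qed.

Lemma proportional_sym : symmetric proportional.
Proof.
move=> A B; apply/asboolP/asboolP => -[c c0 ->]; exists c^-1;
  by rewrite ?invr_eq0 // scalerA mulVf // scale1r.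
Qed.

Lemma proportional_trans : transitive proportional.
Proof.
move=> B A C /asboolP[c c0 eA] /asboolP[d d0 eB]; apply/asboolP.
by exists (c * d); rewrite ?mulf_neq0 // eA eB scalerA.
Qed.

Canonical proportional_equiv :=
  EquivRel proportional proportional_refl proportional_sym proportional_trans.

Definition PGL2 := {eq_quot proportional}.
HB.instance Definition _ := Choice.on PGL2.
HB.instance Definition _ := EqQuotient.on PGL2.

Definition PGL2_one : PGL2 := \pi_PGL2 GL2_one.
Definition PGL2_mul (g h : PGL2) : PGL2 := \pi_PGL2 (GL2_mul (repr g) (repr h)).
Definition PGL2_inv (g : PGL2) : PGL2 := \pi_PGL2 (GL2_inv (repr g)).

Lemma PGL2_eq (A B : GL2) (c : F) : c != 0 ->
  (A : 'M[F]_2) = c *: (B : 'M[F]_2) ->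
  \pi_PGL2 A = \pi_PGL2 B.
Proof. by move=> c0 e; apply/eqmodP/asboolP; exists c. Qed.

Lemma PGL2_repr (A : GL2) : exists2 c : F, c != 0 &
  (repr (\pi_PGL2 A) : 'M[F]_2) = c *: (A : 'M[F]_2).
Proof. by have /eqmodP/asboolP := reprK (\pi_PGL2 A). Qed.

Lemma PGL2_mul_pi (A B : GL2) :
  PGL2_mul (\pi_PGL2 A) (\pi_PGL2 B) = \pi_PGL2 (GL2_mul A B).
Proof.
have [c c0 eA] := PGL2_repr A; have [d d0 eB] := PGL2_repr B.
apply: (PGL2_eq (mulf_neq0 c0 d0)).
by rewrite /= eA eB -scalemxAl -scalemxAr scalerA.
Qed.

Lemma PGL2_inv_pi (A : GL2) : PGL2_inv (\pi_PGL2 A) = \pi_PGL2 (GL2_inv A).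
Proof.
have [c c0 eA] := PGL2_repr A.
apply: (@PGL2_eq _ _ c^-1); rewrite ?invr_eq0 //=.
by rewrite eA invmxZ // -?eA ?GL2_unit.
Qed.

Lemma PGL2_mulA : associative PGL2_mul.
Proof.
elim/quotW=> A; elim/quotW=> B; elim/quotW=> C.
rewrite (PGL2_mul_pi B) (PGL2_mul_pi A B) !PGL2_mul_pi.
by apply: (PGL2_eq (oner_neq0 _)); rewrite /= scale1r mulmxA.
Qed.

Lemma PGL2_mul1 : left_id PGL2_one PGL2_mul.
Proof.
elim/quotW=> A; rewrite PGL2_mul_pi.
by apply: (PGL2_eq (oner_neq0 _)); rewrite /= scale1r mul1mx.
Qed.

Lemma PGL2_1mul : right_id PGL2_one PGL2_mul.
Proof.
elim/quotW=> A; rewrite PGL2_mul_pi.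
by apply: (PGL2_eq (oner_neq0 _)); rewrite /= scale1r mulmx1.
Qed.

Lemma PGL2_mulV : left_inverse PGL2_one PGL2_inv PGL2_mul.
Proof.
elim/quotW=> A; rewrite PGL2_inv_pi PGL2_mul_pi.
by apply: (PGL2_eq (oner_neq0 _)); rewrite /= scale1r mulVmx // GL2_unit.
Qed.

Lemma PGL2_Vmul : right_inverse PGL2_one PGL2_inv PGL2_mul.
Proof.
elim/quotW=> A; rewrite PGL2_inv_pi PGL2_mul_pi.
by apply: (PGL2_eq (oner_neq0 _)); rewrite /= scale1r mulmxV // GL2_unit.
Qed.

HB.instance Definition _ := isGroup.Build PGL2
  PGL2_mulA PGL2_mul1 PGL2_1mul PGL2_mulV PGL2_Vmul.
HB.instance Definition _ := isPointed.Build PGL2 PGL2_one.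

End PGL2.

Section PadicNat.
Variables (p : nat) (p_pr : prime p).
Local Notation Zp := (padic_int p_pr).

Lemma residue_nat m n : (m%:R : Zp) n = (m%:Z %% (p ^ n)%N%:Z)%Z.
Proof.
elim: m => [|m IH]; first by [].
by rewrite -natr1 [LHS]/= IH modzDm -addn1 PoszD.
Qed.

Lemma padic_p_neq0 : (p%:R : Zp) != 0.
Proof.
apply/eqP => /(congr1 (fun x : Zp => x 2)); rewrite residue_nat [RHS]mod0z.
have p1 := prime_gt1 p_pr; rewrite modz_small ?ltz_nat.
  by case: p p1.
by rewrite /= -[X in (X < _)%N]expn1 ltn_exp2l.
Qed.

Lemma padic_p_nonunit (x : Zp) : p%:R * x != 1.
Proof.
apply/eqP => /(congr1 (fun x : Zp => x 1)) /=.
rewrite residue_nat expn1 modzz mul0r mod0z modz_small // ltz_nat.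
exact: prime_gt1.
Qed.

End PadicNat.

Section Tree.
Variables (q : nat) (q_pr : prime q).

Definition padic := {fraction padic_int q_pr}.

Local Notation Zq := (padic_int q_pr).
Local Notation Qq := padic.
Local Notation G := (PGL2 Qq).
Local Notation "x %:F" := (FracField.tofrac (x : Zq) : Qq).

(* The Zq-span of the columns of B; a lattice is the Zq-span of a basis. *)
Definition lattice_span (B : 'M[Qq]_2) : set 'cV[Qq]_2 :=
  [set B *m map_mx (@FracField.tofrac Zq) w | w in [set: 'cV[Zq]_2]].

Record lattice := Lattice {
  lattice_set :> set 'cV[Qq]_2 ;
  _ : exists2 B, B \in unitmx & lattice_set = lattice_span B }.

HB.instance Definition _ := gen_eqMixin lattice.
HB.instance Definition _ := gen_choiceMixin lattice.

Lemma lattice_eq (L L' : lattice) : (L : set _) = L' -> L = L'.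
Proof.
case: L L' => [L hL] [L' hL'] /= e; case: _ / e hL' => hL'.
by congr Lattice; exact: Prop_irrelevance.
Qed.

Lemma lattice_act_subproof (A : GL2 Qq) (L : lattice) :
  exists2 B, B \in unitmx &
    [set (A : 'M[Qq]_2) *m v | v in L] = lattice_span B.
Proof.
case: L => L [B uB e] /=; exists ((A : 'M[Qq]_2) *m B).
  by rewrite unitmx_mul GL2_unit.
rewrite e /lattice_span image_comp; apply: eq_imagel => w _ /=.
by rewrite mulmxA.
Qed.

Definition lattice_act (A : GL2 Qq) (L : lattice) : lattice :=
  Lattice (lattice_act_subproof A L).

Definition homothetic (L L' : lattice) : bool :=
  `[< exists2 c : Qq, c != 0 & (L : set _) = [set c *: v | v in L'] >].

Lemma homothetic_refl : reflexive homothetic.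
Proof.
move=> L; apply/asboolP; exists 1; rewrite ?oner_neq0 //.
by under eq_imagel do rewrite scale1r; rewrite image_id.
Qed.

Lemma homothetic_trans : transitive homothetic.
Proof.
move=> L' L L'' /asboolP[c c0 e] /asboolP[d d0 e']; apply/asboolP.
exists (c * d); first by rewrite mulf_neq0.
by rewrite e e' image_comp; apply: eq_imagel => v _ /=; rewrite scalerA.
Qed.

Lemma homothetic_sym : symmetric homothetic.
Proof.
suff h L L' : homothetic L L' -> homothetic L' L.
  by move=> L L'; apply/idP/idP; exact: h.
move=> /asboolP[c c0 e]; apply/asboolP; exists c^-1; rewrite ?invr_eq0 //.
rewrite e image_comp -[LHS]image_id; apply: eq_imagel => v _ /=.
by rewrite scalerA mulVf // scale1r.
Qed.

Canonical homothetic_equiv :=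
  EquivRel homothetic homothetic_refl homothetic_sym homothetic_trans.

Definition vertex := {eq_quot homothetic}.
HB.instance Definition _ := Choice.on vertex.
HB.instance Definition _ := EqQuotient.on vertex.

Lemma vertex_eq (L L' : lattice) (c : Qq) : c != 0 ->
  (L : set _) = [set c *: v | v in L'] -> \pi_vertex L = \pi_vertex L'.
Proof. by move=> c0 e; apply/eqmodP/asboolP; exists c. Qed.

Lemma vertex_repr (L L' : lattice) : \pi_vertex L = \pi_vertex L' ->
  exists2 c : Qq, c != 0 & (L : set _) = [set c *: v | v in L'].
Proof. by move/eqmodP/asboolP. Qed.

Definition vact (g : G) (v : vertex) : vertex :=
  \pi_vertex (lattice_act (repr g) (repr v)).

Lemma vact_pi (A : GL2 Qq) (L : lattice) :
  vact (\pi_(PGL2 Qq) A) (\pi_vertex L) = \pi_vertex (lattice_act A L).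
Proof.
have [c c0 eA] := PGL2_repr A.
have [d d0 eL] := vertex_repr (reprK (\pi_vertex L)).
apply: (vertex_eq (mulf_neq0 c0 d0)).
rewrite /= eL eA !image_comp; apply: eq_imagel => v _ /=.
by rewrite -scalemxAl -scalemxAr scalerA.
Qed.

Lemma vact1 (v : vertex) : vact 1%g v = v.
Proof.
elim/quotW: v => L; rewrite vact_pi; congr (\pi_vertex _).
apply: lattice_eq; rewrite /= -[RHS]image_id.
by apply: eq_imagel => w _; rewrite mul1mx.
Qed.

Lemma vactM (g h : G) (v : vertex) : vact (g * h)%g v = vact g (vact h v).
Proof.
elim/quotW: g => A; elim/quotW: h => B; elim/quotW: v => L.
rewrite [(_ * _)%g]PGL2_mul_pi (vact_pi B) !vact_pi; congr (\pi_vertex _).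
apply: lattice_eq; rewrite /= image_comp.
by apply: eq_imagel => w _; rewrite /= mulmxA.
Qed.

Lemma vactK g : cancel (vact g) (vact g^-1%g).
Proof. by move=> v; rewrite -vactM mulVg vact1. Qed.

Definition adjacent (v w : vertex) : Prop :=
  v <> w /\ exists L L' : lattice,
    [/\ \pi_vertex L = v, \pi_vertex L' = w,
        [set q%:R *: u | u in L] `<` L' & L' `<` L].

Definition walk (n : nat) (v w : vertex) : Prop :=
  exists r : nat -> vertex,
    [/\ r 0%N = v, r n = w & forall i, (i < n)%N -> adjacent (r i) (r i.+1)].

Definition tdist (v w : vertex) : nat :=
  xget 0%N [set n | walk n v w /\ forall m, walk m v w -> (n <= m)%N].

Definition geodesic (r : nat -> vertex) : Prop :=
  forall m n, (m <= n)%N -> tdist (r m) (r n) = (n - m)%N.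

Lemma adjacent_vact g v w : adjacent v w -> adjacent (vact g v) (vact g w).
Proof.
move=> [vw [L [L' [ev ew qL L'L]]]]; split.
  by move=> e; exact: (vw (can_inj (vactK g) e)).
rewrite -{}ev -{}ew.
elim/quotW: g => A {vw}; exists (lattice_act A L), (lattice_act A L').
have AI : injective (mulmx A : 'cV_2 -> 'cV_2).
  exact: (can_inj (mulKmx (GL2_unit A))).
have im_proper (S T : set 'cV[Qq]_2) : S `<` T ->
    [set (A : 'M[Qq]_2) *m u | u in S] `<` [set (A : 'M[Qq]_2) *m u | u in T].
  move=> [ST nTS]; split; first exact: image_subset.
  by move=> h; apply: nTS => u Tu; have [|u' Su' /AI <-] := h (A *m u);
    first exists u.
rewrite !vact_pi; split=> //; last exact: im_proper.
rewrite /= image_comp.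
rewrite (_ : [set _ | _ in _] = [set (A : 'M[Qq]_2) *m u |
  u in [set q%:R *: u | u in (L : set _)]]); first exact: im_proper.
by rewrite image_comp; apply: eq_imagel => u _ /=; rewrite scalemxAr.
Qed.

Lemma walk_vact g n v w : walk n v w -> walk n (vact g v) (vact g w).
Proof.
move=> [r [<- <- r_adj]]; exists (vact g \o r); split=> // i ni.
exact/adjacent_vact/r_adj.
Qed.

Lemma tdist_vact g v w : tdist (vact g v) (vact g w) = tdist v w.
Proof.
have walkE n : walk n (vact g v) (vact g w) = walk n v w.
  apply/propext; split; last exact: walk_vact.
  by move/(walk_vact g^-1%g); rewrite !vactK.
by rewrite /tdist; congr xget; apply/funext => n /=;
  under eq_forall do rewrite walkE; rewrite walkE.
Qed.

Definition std_lattice_mx (n : nat) : 'M[Qq]_2 :=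
  diag_mx (\row_j (if j == 0 then 1 else q%:R ^+ n)).

Lemma std_lattice_subproof n : exists2 B, B \in unitmx &
  lattice_span (std_lattice_mx n) = lattice_span B.
Proof.
exists (std_lattice_mx n) => //; rewrite unitmxE det_diag big_ord_recl big_ord1.
rewrite !mxE /= mul1r unitfE expf_eq0 -tofrac1.
rewrite -(rmorph_nat (@FracField.tofrac Zq)).
by rewrite tofrac_eq0 (negPf (padic_p_neq0 q_pr)) andbF.
Qed.

Definition std_lattice n : lattice := Lattice (std_lattice_subproof n).

Lemma std_latticeP n (u : 'cV[Qq]_2) : (std_lattice n : set _) u <->
  exists a b : Zq, u 0 0 = a%:F /\ u 1 0 = q%:R ^+ n * b%:F.
Proof.
split=> [[w _ <-]|[a [b [u0 u1]]]].
  by exists (w 0 0), (w 1 0); rewrite mul_diag_mx !mxE /= mul1r.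
exists (\col_i (if i == 0 then a else b)) => //.
apply/colP => i; rewrite mul_diag_mx !mxE.
have [->|] := eqVneq i 0; first by rewrite mul1r u0.
by case: i => [[|[|//]]] // ? _; rewrite -u1; congr (u _ _); exact: val_inj.
Qed.

Lemma lattice_scale_subproof (c : Qq) (L : lattice) : c != 0 ->
  exists2 B, B \in unitmx & [set c *: v | v in L] = lattice_span B.
Proof.
move=> c0; case: L => L [B uB e] /=; exists (c *: B).
  by rewrite unitmxZ // unitfE.
by rewrite e /lattice_span image_comp; apply: eq_imagel => w _ /=;
  rewrite scalemxAl.
Qed.

Definition lattice_scale c L (c0 : c != 0) : lattice :=
  Lattice (@lattice_scale_subproof c L c0).

Lemma walk_sublattice n v w (L : lattice) : walk n v w -> \pi_vertex L = v ->
  exists L' : lattice, [/\ \pi_vertex L' = w,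
    [set q%:R ^+ n *: u | u in L] `<=` L' & L' `<=` L].
Proof.
elim: n w => [|n IH] w [r [r0 rn r_adj]] Lv.
  exists L; split=> //; first by rewrite Lv -r0 rn.
  by move=> _ [u Lu <-]; rewrite expr0 scale1r.
have [||L1 [L1r qL1 L1L]] // := IH (r n).
  by exists r; split=> // i ni; apply: r_adj; exact: ltnW.
have [_ [L2 [L3 [L2r L3r [qL2 _] [L32 _]]]]] := r_adj n (ltnSn n).
have [c c0 eL1] := vertex_repr (etrans L1r (esym L2r)).
exists (lattice_scale L3 c0); split.
- by rewrite -rn -L3r; exact: (vertex_eq c0).
- move=> _ [u Lu <-].
  have : (L1 : set _) (q%:R ^+ n *: u) by apply: qL1; exists u.
  rewrite eL1 => -[u' L2u' e]; exists (q%:R *: u').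
    by apply: qL2; exists u'.
  by rewrite exprS -scalerA -e !scalerA mulrC.
- apply: subset_trans L1L; rewrite eL1 => _ [u L3u <-].
  by exists u => //; exact: L32.
Qed.

Lemma tofrac_nat (m : nat) : (m%:R : Zq)%:F = m%:R.
Proof. exact: rmorph_nat. Qed.

Lemma walk_std m n k : walk k (\pi_vertex (std_lattice m))
  (\pi_vertex (std_lattice n)) -> (n <= m + k)%N.
Proof.
move=> /walk_sublattice/(_ erefl)[L' [/vertex_repr[c c0 eL'] qL L'L]].
have [a ca] : exists a : Zq, c = a%:F.
  pose u : 'cV[Qq]_2 := \col_i (if i == 0 then 1 else 0).
  have /L'L/std_latticeP[a [_ [+ _]]] : (L' : set _) (c *: u).
    rewrite eL'; exists u => //; apply/std_latticeP; exists 1, 0.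
    by rewrite !mxE /= tofrac1 tofrac0 mulr0.
  by rewrite !mxE /= mulr1 => ->; exists a.
pose u : 'cV[Qq]_2 := \col_i (if i == 0 then 0 else q%:R ^+ m).
have : (L' : set _) (q%:R ^+ k *: u).
  apply: qL; exists u => //; apply/std_latticeP; exists 0, 1.
  by rewrite !mxE /= tofrac1 tofrac0 mulr1.
rewrite eL' => -[v /std_latticeP[_ [b [_ vb]]] /matrixP/(_ 1 0)].
rewrite !mxE /= vb ca -!tofrac_nat -!tofracXn -!tofracM => /eqP.
rewrite tofrac_eq -exprD leqNgt => e; apply/negP => mkn.
have nE : n = (k + m + (n - (m + k).+1).+1)%N by lia.
move: e; rewrite mulrCA nE exprD -mulrA.
rewrite -[X in _ == X]mulr1 (inj_eq (mulfI _)); last first.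
  by rewrite expf_neq0 // padic_p_neq0.
by rewrite exprS -mulrA (negPf (padic_p_nonunit _)).
Qed.

Lemma std_adjacent n : adjacent (\pi_vertex (std_lattice n))
  (\pi_vertex (std_lattice n.+1)).
Proof.
split.
  move=> e; have : walk 0 (\pi_vertex (std_lattice n))
      (\pi_vertex (std_lattice n.+1)).
    by exists (fun=> \pi_vertex (std_lattice n)); split.
  by move/walk_std; rewrite addn0 ltnn.
exists (std_lattice n), (std_lattice n.+1); split=> //; split.
- move=> _ [u /std_latticeP[a [b [u0 u1]]] <-]; apply/std_latticeP.
  exists (q%:R * a), b; rewrite !mxE u0 u1 tofracM tofrac_nat; split=> //.
  by rewrite exprS mulrA.
- pose u : 'cV[Qq]_2 := \col_i (if i == 0 then 1 else 0).
  move=> /(_ u)[].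
    by apply/std_latticeP; exists 1, 0; rewrite !mxE /= tofrac1 tofrac0 mulr0.
  move=> v /std_latticeP[a [_ [va _]]] /matrixP/(_ 0 0).
  rewrite !mxE /= va -tofrac_nat -tofracM -tofrac1 => /eqP.
  by rewrite tofrac_eq (negPf (padic_p_nonunit _)).
- move=> u /std_latticeP[a [b [u0 u1]]]; apply/std_latticeP.
  exists a, (q%:R * b); rewrite u0 u1 tofracM tofrac_nat; split=> //.
  by rewrite exprSr mulrA.
- pose u : 'cV[Qq]_2 := \col_i (if i == 0 then 0 else q%:R ^+ n).
  move=> /(_ u) h; have /h/std_latticeP[_ [b [_]]] : (std_lattice n : set _) u.
    by apply/std_latticeP; exists 0, 1; rewrite !mxE /= tofrac1 tofrac0 mulr1.
  rewrite !mxE /= -tofrac_nat -!tofracXn -tofracM => /eqP.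
  rewrite tofrac_eq exprSr -mulrA -[X in X == _]mulr1 (inj_eq (mulfI _)).
    by rewrite eq_sym (negPf (padic_p_nonunit _)).
  by rewrite expf_neq0 // padic_p_neq0.
Qed.

Lemma std_lattice0 :
  (std_lattice 0 : set _) = range (map_mx (@FracField.tofrac Zq)).
Proof.
have -> : (std_lattice 0 : set _) = lattice_span 1%:M.
  congr lattice_span; apply/matrixP => i j; rewrite !mxE.
  by case: (i == j); rewrite ?mulr1n // expr0 if_same.
by apply: eq_imagel => w _; rewrite mul1mx.
Qed.

Definition origin : vertex := \pi_vertex (std_lattice 0).

Definition std_ray (n : nat) : vertex := \pi_vertex (std_lattice n).

Lemma std_ray_geodesic : geodesic std_ray.
Proof.
move=> m n mn; rewrite /tdist; case: xgetP => [k _ [kw kmin]|/(_ (n - m)%N)].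
  apply/eqP; rewrite eqn_leq leq_subLR (walk_std kw) andbT; apply: kmin.
  exists (fun i => std_ray (m + i)); rewrite addn0 subnKC //; split=> // i _.
  by rewrite addnS; exact: std_adjacent.
case; split.
  exists (fun i => std_ray (m + i)); rewrite addn0 subnKC //; split=> // i _.
  by rewrite addnS; exact: std_adjacent.
by move=> k /walk_std; rewrite leq_subLR.
Qed.

End Tree.

Section Boundary.
Variables (q : nat) (q_pr : prime q).

Local Notation Qq := (padic q_pr).
Local Notation G := (PGL2 Qq).
Local Notation vertex := (vertex q_pr).
Local Notation o := (origin q_pr).

Record ray := Ray { ray_fun :> nat -> vertex ; _ : geodesic ray_fun }.

HB.instance Definition _ := gen_eqMixin ray.
HB.instance Definition _ := gen_choiceMixin ray.

Lemma ray_geodesic (r : ray) : geodesic r. Proof. by case: r. Qed.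

Definition cofinal (r s : ray) : bool :=
  `[< exists m n, forall i, r (m + i)%N = s (n + i)%N >].

Lemma cofinal_refl : reflexive cofinal.
Proof. by move=> r; apply/asboolP; exists 0%N, 0%N. Qed.

Lemma cofinal_sym : symmetric cofinal.
Proof.
by move=> r s; apply/asboolP/asboolP => -[m [n e]]; exists n, m => i; rewrite e.
Qed.

Lemma cofinal_trans : transitive cofinal.
Proof.
move=> s r t /asboolP[m [n e]] /asboolP[k [l e']]; apply/asboolP.
by exists (m + k)%N, (l + n)%N => i; rewrite -!addnA e addnCA e'.
Qed.

Canonical cofinal_equiv :=
  EquivRel cofinal cofinal_refl cofinal_sym cofinal_trans.

Definition boundary := {eq_quot cofinal}.
HB.instance Definition _ := Choice.on boundary.
HB.instance Definition _ := EqQuotient.on boundary.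
HB.instance Definition _ :=
  isPointed.Build boundary (\pi_boundary (Ray (@std_ray_geodesic q q_pr))).

Definition ray_from (v : vertex) (w : boundary) : ray :=
  xget (repr w) [set r : ray | r 0%N = v /\ \pi_boundary r = w].

Lemma ray_act_subproof (g : G) (r : ray) : geodesic (vact g \o r).
Proof. by move=> m n mn; rewrite tdist_vact ray_geodesic. Qed.

Definition ray_act (g : G) (r : ray) : ray := Ray (ray_act_subproof g r).

Definition bact (g : G) (w : boundary) : boundary :=
  \pi_boundary (ray_act g (repr w)).

(* A neighbourhood basis of w is given, for n in nat, by the ends whose ray   *)
(* from the origin coincides with [o, w) up to the n-th vertex.               *)
Definition boundary_open (U : set boundary) : Prop := forall w, U w ->
  exists n, forall w',
    (forall i, (i <= n)%N -> ray_from o w' i = ray_from o w i) -> U w'.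

Lemma boundary_openT : boundary_open setT.
Proof. by move=> w _; exists 0%N. Qed.

Lemma boundary_openI : setI_closed boundary_open.
Proof.
move=> U V oU oV w [/oU[m Um] /oV[n Vn]]; exists (maxn m n) => w' e.
split; [apply: Um | apply: Vn] => i il; apply: e.
  exact: leq_trans il (leq_maxl _ _).
exact: leq_trans il (leq_maxr _ _).
Qed.

Lemma boundary_open_bigU (I : Type) (f : I -> set boundary) :
  (forall i, boundary_open (f i)) -> boundary_open (\bigcup_i f i).
Proof.
move=> fo w [i _ /fo[n fn]]; exists n => w' e; exists i => //; exact: fn.
Qed.

HB.instance Definition _ := isOpenTopological.Build boundary
  boundary_openT boundary_openI boundary_open_bigU.

Definition ray_edges (r : ray) : set (set vertex) :=
  [set [set r n; r n.+1] | n in [set: nat]].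

(* The number |w /\ w'|; it is 0 by convention when w = w'. *)
Definition confluence (w w' : boundary) : nat :=
  #|` fset_set (ray_edges (ray_from o w) `&` ray_edges (ray_from o w'))|.

Definition sphere (n : nat) : set vertex := [set v | tdist o v = n].

Definition ball_stab (N : nat) : set G :=
  [set g | forall v, (tdist v o <= N)%N -> vact g v = v].

Definition origin_stab : set G := [set g | vact g o = o].

Section Real.
Variable R : realType.

(* b(g)(w), x being any vertex common to the two rays. *)
Definition busemann (g : G) (w : boundary) : R :=
  let x := xget o (range (ray_from o w) `&` range (ray_from (vact g o) w)) in
  (tdist o x)%:R - (tdist (vact g o) x)%:R.

(* The sums are taken in [0, +oo]; the value is finite, since the sphere of   *)
(* radius n has (q + 1) q^(n - 1) vertices.                                   *)
Definition Delta (g h : G) : \bar R :=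
  let d v : R := (tdist (vact g v) (vact h v))%:R in
  ((d o)%:E + \sum_(1 <= n <oo)
     \esum_(v in sphere n) (d v / (q.+1%:R ^+ n * (1 + d v)))%:E)%E.

(* The open sets of G: Delta generates its topology. *)
Definition Delta_open (U : set G) : Prop := forall g, U g ->
  exists2 e : R, 0 < e & forall h, (Delta g h < e%:E)%E -> U h.

End Real.
End Boundary.

Notation borel T := (g_sigma_algebraType (@open T)) (only parsing).

Definition cexp (R : realType) (z : R[i]) : R[i] :=
  (expR (complex.Re z) * cos (complex.Im z)) +i*
  (expR (complex.Re z) * sin (complex.Im z)).

Section InnerProduct.
Variables (R : realType) (V : lmodType R[i]) (ip : {dot V for Num.conj}).

Definition sqnorm (v : V) : R := complex.Re (ip v v).

Definition ip_complete : Prop := forall u : nat -> V,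
  (forall e : R, 0 < e -> exists N, forall m n, (N <= m)%N -> (N <= n)%N ->
     sqnorm (u m - u n) < e) ->
  exists l, forall e : R, 0 < e -> exists N, forall n, (N <= n)%N ->
    sqnorm (u n - l) < e.

Definition ip_bounded (f : V -> V) : Prop :=
  exists M : R, forall v, sqnorm (f v) <= M * sqnorm v.

End InnerProduct.

Definition step_fun d (X : measurableType d) (T : Type) (f : X -> T) : Prop :=
  exists n (A : 'I_n -> set X),
    [/\ forall i, measurable (A i), trivIset setT A, \bigcup_i A i = setT &
        forall i x y, A i x -> A i y -> f x = f y].

Section L2.
Variables (R : realType) (d : measure_display) (X : measurableType d).
Variable mu : {measure set X -> \bar R}.
Variables (H : lmodType R[i]) (ip : {dot H for Num.conj}).

Definition strongly_measurable (u : X -> H) : Prop :=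
  exists2 s : nat -> X -> H, (forall n, step_fun (s n)) &
    forall x (e : R), 0 < e ->
      exists N, forall n, (N <= n)%N -> sqnorm ip (s n x - u x) < e.

Definition square_integrable (u : X -> H) : Prop :=
  strongly_measurable u /\ (\int[mu]_x (sqnorm ip (u x))%:E < +oo)%E.

Definition cintegral (f : X -> R[i]) : R[i] :=
  (\int[mu]_x complex.Re (f x)) +i* (\int[mu]_x complex.Im (f x)).

(* HX is L^2(X, mu; H), cls being the map that sends a square integrable      *)
(* function to its class.                                                     *)
Record is_L2 (HX : lmodType R[i]) (ipX : {dot HX for Num.conj})
    (cls : (X -> H) -> HX) : Prop := {
  L2_linear : forall a u v, square_integrable u -> square_integrable v ->
    cls (fun x => a *: u x + v x) = a *: cls u + cls v ;
  L2_ip : forall u v, square_integrable u -> square_integrable v ->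
    ipX (cls u) (cls v) = cintegral (fun x => ip (u x) (v x)) ;
  L2_surj : forall h, exists2 u, square_integrable u & cls u = h }.

End L2.

(* The exponential vectors determine the symmetric Fock space E over H up to  *)
(* a unique isometry.                                                         *)
Record is_fock (R : realType) (H : lmodType R[i]) (ip : {dot H for Num.conj})
    (E : lmodType R[i]) (ipE : {dot E for Num.conj}) (EXP : H -> E) : Prop := {
  fock_complete : ip_complete ipE ;
  fock_ip : forall u v, ipE (EXP u) (EXP v) = cexp (ip u v) ;
  fock_total : forall (w : E) (e : R), 0 < e ->
    exists n (a : 'I_n -> R[i]) (u : 'I_n -> H),
      sqnorm ipE (w - \sum_(i < n) a i *: EXP (u i)) < e }.

Section Steinberg.
Variables (R : realType) (q : nat) (q_pr : prime q).

Local Notation G := (PGL2 (padic q_pr)).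
Local Notation Omega := (boundary q_pr).

Variable nu : probability (borel Omega) R.

Definition K_invariant : Prop := forall k, origin_stab k ->
  forall A : set (borel Omega), measurable A -> nu (bact k @^-1` A) = nu A.

Definition locally_constant (F : Omega -> R[i]) : Prop :=
  forall w, \forall w' \near w, F w' = F w.

Definition steinberg_sqnorm (F : Omega -> R[i]) : R :=
  (q%:R ^+ 2 - 1) / (4 * q%:R) *
  \int[nu]_w \int[nu]_w'
    (Normc.normc (F w - F w') ^+ 2 * q%:R ^+ (2 * confluence w w')).

Definition bfun (g : G) : Omega -> R[i] := fun w => (busemann R g w)%:C.

(* Up to a unique isometry, Hq is the completion of the space of locally      *)
(* constant functions modulo constants, the squared norm being multiplied by  *)
(* log q; iota F is the class of F.                                           *)
Record is_steinberg_space (Hq : lmodType R[i]) (ip : {dot Hq for Num.conj})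
    (iota : (Omega -> R[i]) -> Hq) : Prop := {
  steinberg_complete : ip_complete ip ;
  steinberg_linear : forall a F F', locally_constant F -> locally_constant F' ->
    iota (fun w => a * F w + F' w) = a *: iota F + iota F' ;
  steinberg_norm : forall F, locally_constant F ->
    sqnorm ip (iota F) = ln q%:R * steinberg_sqnorm F ;
  steinberg_dense : forall (h : Hq) (e : R), 0 < e ->
    exists2 F, locally_constant F & sqnorm ip (h - iota F) < e }.

(* The continuous extension to the completion of F |-> F o g^-1. *)
Record is_steinberg_rep (Hq : lmodType R[i]) (ip : {dot Hq for Num.conj})
    (iota : (Omega -> R[i]) -> Hq) (St : G -> {linear Hq -> Hq}) : Prop := {
  steinberg_rep_bounded : forall g, ip_bounded ip (St g) ;
  steinberg_rep_fun : forall g F, locally_constant F ->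
    St g (iota F) = iota (fun w => F (bact g^-1%g w)) }.

End Steinberg.

Section Currents.
Variables (R : realType) (q : nat) (q_pr : prime q) (X : ptopologicalType).

Local Notation G := (PGL2 (padic q_pr)).

(* G^0 and the group of bounded measurable currents (the completion of G^0    *)
(* for delta), as sets of maps X -> G with the pointwise group operations;    *)
(* maps are not identified up to null sets, delta being a true supremum.      *)
Definition step_currents : set (X -> G) :=
  [set xi | @step_fun _ (borel X) G xi].

Definition bounded_currents : set (X -> G) := [set xi |
  @measurable_fun _ _ (borel X) (g_sigma_algebraType (@Delta_open q q_pr R))
    setT xi /\
  exists N (s : seq G), forall x,
    exists2 g, g \in s & @ball_stab q q_pr N (g^-1 * xi x)%g].

Definition delta (xi eta : X -> G) : \bar R :=
  ereal_sup [set Delta R (xi x) (eta x) | x in [set: X]].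

Definition delta_continuous (S : set (X -> G))
    (phi : (X -> G) -> R[i]) : Prop :=
  forall xi, S xi -> forall e : R, 0 < e -> exists2 r : R, 0 < r &
    forall eta, S eta -> (delta xi eta < r%:E)%E ->
      Normc.normc (phi eta - phi xi) < e.

Definition positive_definite (S : set (X -> G))
    (phi : (X -> G) -> R[i]) : Prop :=
  forall n (xi : 'I_n -> X -> G) (c : 'I_n -> R[i]), (forall i, S (xi i)) ->
    0 <= \sum_(i < n) \sum_(j < n)
           c i * (c j)^* * phi (fun x => (xi j x)^-1 * xi i x)%g.

Section FockRep.
Variables (mu : {measure set (borel X) -> \bar R}).
Variables (Hq : lmodType R[i]) (ipq : {dot Hq for Num.conj}).
Variable iota : (boundary q_pr -> R[i]) -> Hq.
Variable St : G -> {linear Hq -> Hq}.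
Variables (HX : lmodType R[i]) (ipX : {dot HX for Num.conj}).
Variable cls : (borel X -> Hq) -> HX.
Variables (E : lmodType R[i]) (ipE : {dot E for Num.conj}) (EXP : HX -> E).

Record is_fock_rep (Xi : (X -> G) -> {linear E -> E}) : Prop := {
  fock_rep1 : forall w, Xi (fun=> 1%g) w = w ;
  fock_repM : forall xi eta, step_currents xi -> step_currents eta ->
    forall w, Xi (fun x => xi x * eta x)%g w = Xi xi (Xi eta w) ;
  fock_rep_unitary : forall xi, step_currents xi ->
    forall w w', ipE (Xi xi w) (Xi xi w') = ipE w w' ;
  fock_rep_exp : forall xi, step_currents xi ->
    forall v, square_integrable mu ipq v ->
    let b := cls (fun x => iota (bfun R (xi x))) in
    let Stv := cls (fun x => St (xi x) (v x)) in
    Xi xi (EXP (cls v)) =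
      cexp (- 2^-1 * ipX b b - ipX Stv b) *: EXP (Stv + b) }.

End FockRep.
End Currents.

Arguments step_currents {q q_pr X}.
Arguments bounded_currents R {q q_pr X}.

(* Main.v *)
(* A vector b(g) depends on g only through the vertex g.o, so the formula for *)
(* the vacuum coefficient extends it to bounded currents as a function that   *)
(* is even constant on delta-balls of radius 1/2. Positive definiteness, and  *)
(* uniqueness by density, come from replacing a bounded current xi by a step  *)
(* current that moves every vertex of a given ball about o as xi does: as     *)
(* balls of the tree are finite, xi takes only finitely many values modulo    *)
(* the stabilizer of the ball. On step currents the coefficient is computed   *)
(* from the Fock representation, provided that b(g) is locally constant.      *)
(* This, and the bound (q + 1) q^(n - 1) for the spheres, which makes Delta   *)
(* small on the stabilizers of large balls, rest on the geometry of the tree: *)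
(* by the Cartan decomposition G = K A K every vertex is k.std_n with k in K, *)
(* and its neighbours are at distance n + 1 from o except k.std_(n - 1).      *)

Require Import Defs.
From HB Require Import structures.
From mathcomp Require Import all_boot all_order all_algebra.
From mathcomp Require Import complex finmap zify ring lra.
From mathcomp Require Import all_classical all_reals all_analysis.

Set Implicit Arguments.
Unset Strict Implicit.
Unset Printing Implicit Defensive.

Import Order.TTheory GRing.Theory Num.Theory.

Local Open Scope classical_set_scope.
Local Open Scope quotient_scope.
Local Open Scope complex_scope.
Local Open Scope ring_scope.

(** * Valuations of p-adic numbers *)

(** On a step current the Fock formula carries the vacuum [EXP 0] to a multiple of [EXP b], and
    pairing with [EXP 0] leaves exp(-|b|^2/2); the factor log q in the norm turns this into a power
    of q ([vacuum_coefficient]). Positive definiteness on step currents holds because the kernel is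
    the Gram kernel of the vectors [Xi (xi i) (EXP 0)] ([vacuum_positive_definite]).

    The closed formula [vacuum_form] sees a current only through x |-> xi(x).o
    ([vacuum_form_origin]), and this map does not change under a perturbation of size less than 1/2
    ([delta_lt1_origin]), whence continuity. A finite family of bounded currents can be replaced by
    step currents without changing any value of the kernel ([step_approx_family]), so positivity
    passes to bounded currents. Uniqueness is density: [step_approx] with [delta_ball_small].

    The geometric input is the list of neighbours in [adjacent_std]. It gives the two tree
    properties [adjacent_dist] and [closer_unique], on which the formula [busemannE] for b(g) rests,
    and the count [sphere_bound], which makes the tail of [Delta] geometric ([Delta_ball_le]). *)

Lemma tofrac_surj (D : idomainType) (z : {fraction D}) :
  exists a b : D, b != 0 /\ z * FracField.tofrac b = FracField.tofrac a.
Proof.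
elim/quotW: z => r; exists (frac r).1, (frac r).2.
split; first exact: denom_ratioP.
rewrite !piE; apply/eqmodP; rewrite /= FracField.equivfE /FracField.mulf /=.
by rewrite !numden_Ratio ?oner_neq0 ?mulr1 ?denom_ratioP // mulrC.
Qed.

(** The quotient z is p^(m-n) u/v; the sign of m - n decides which of z and its inverse is
    integral. *)
Lemma pivot_fraction (A : idomainType) (F : fieldType) (f : {rmorphism A -> F})
    (p u v a b : A) (m n : nat) (z : F) :
  injective f -> p != 0 -> u \is a GRing.unit -> v \is a GRing.unit ->
  a = p ^+ m * u -> b = p ^+ n * v -> z * f b = f a ->
  (exists t, z = f t) \/ (exists t, z^-1 = f t).
Proof.
move=> f_inj p0 uu vu -> -> zE.
have f0 (x : A) : x != 0 -> f x != 0 by rewrite -(inj_eq f_inj) rmorph0.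
have unit0 (x : A) : x \is a GRing.unit -> x != 0.
  by apply: contraTneq => ->; rewrite unitr0.
have pn0 k : f (p ^+ k) != 0 by rewrite f0 // expf_neq0.
have [u0 v0] := (f0 _ (unit0 _ uu), f0 _ (unit0 _ vu)).
have {zE}-> : z = f (p ^+ m) * f u / (f (p ^+ n) * f v).
  by rewrite -rmorphM -zE rmorphM mulfK // mulf_neq0.
have [nm|mn] := leqP n m; [left; exists (p ^+ (m - n) * u / v)|right;
    exists (p ^+ (n - m) * v / u)].
  rewrite -{1}(subnK nm) exprD !rmorphM rmorphV //.
  by field; rewrite pn0 v0.
rewrite -{1}(subnK (ltnW mn)) exprD !rmorphM rmorphV //.
by field; rewrite !pn0 u0 v0.
Qed.

Section PadicValuation.
Variables (p : nat) (p_pr : prime p).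
Local Notation Zp := (padic_int p_pr).
Local Notation Qp := (padic p_pr).
Local Notation "x %:F" := (FracField.tofrac (x : Zp) : Qp).

Lemma padic_mulE (x y : Zp) n :
  ((x * y) n = x n * y n %[mod (p ^ n)%N%:Z])%Z.
Proof. exact: padic_reduceE. Qed.

Lemma padic_subE (x y : Zp) n :
  ((x - y) n = x n - y n %[mod (p ^ n)%N%:Z])%Z.
Proof.
apply: etrans (padic_reduceE p_pr (padic_addc x (- y)) n) _.
by rewrite /= modzDmr.
Qed.

Lemma coprime_residue (x : Zp) n : x 1%N != 0 -> coprimez (x n) (p ^ n)%N%:Z.
Proof.
case: n => [|n] x1; first by rewrite expn0 /coprimez gcdz1.
rewrite coprimez_sym coprimezE /= coprime_pexpl // prime_coprime //.
by rewrite -[p in (p %| _)%N]expn1 -residue_eq0.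
Qed.

(** A residue prime to p is invertible modulo every p^n by Bezout, and the inverses are compatible
    because inverses modulo p^n are unique. *)
Lemma padic_unitE (x : Zp) : (x \is a GRing.unit) = (x 1%N != 0).
Proof.
apply/idP/idP => [ux|x1].
  apply/eqP => x1; have /(congr1 (fun x : Zp => x 1%N)) := mulVr ux.
  by rewrite /= x1 mulr0 mod0z expn1 modz_small // ltz_nat prime_gt1.
have inv n : exists y : int, (y * x n = 1 %[mod (p ^ n)%N%:Z])%Z.
  have [u [v e]] := Bezoutz (x n) (p ^ n)%N%:Z.
  exists u; move: e; rewrite (eqP (coprime_residue n x1)) => <-.
  by rewrite addrC modzMDl.
have [y yx] := choice inv.
have cy : padic_compat p y.
  move=> n; apply/eqP; rewrite eqz_mod_dvd.
  (* The difference of two successive inverses is a combination of three quantities, each divisible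
     by p^n. *)
  have -> : y n.+1 - y n = y n * (y n.+1 * x n.+1 - 1)
      - y n.+1 * (y n * x n - 1) - y n * y n.+1 * (x n.+1 - x n) by ring.
  rewrite !rpredB // dvdz_mull // -eqz_mod_dvd ?yx // ?residue_compat //.
  by rewrite -(modz_expn p _ (leqnSn n)) yx modz_expn.
suff yx1 : padic_reduce p_pr cy * x = 1.
  by apply/unitrPr; exists (padic_reduce p_pr cy); rewrite mulrC.
by apply: padicP => n; rewrite /= !modz_mod modzMml.
Qed.

(** Dividing by p loses one digit of precision, so the n-th residue of the quotient is read off the
    residue of x of index n + 1. *)
Lemma padic_divp (x : Zp) : x 1%N = 0 -> exists y : Zp, x = p%:R * y.
Proof.
move=> x1; have p0 : p%:Z != 0 by case: p (prime_gt0 p_pr).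
have px n : x n.+1 = p%:Z * (x n.+1 %/ p%:Z)%Z.
  rewrite mulrC divzK // dvdzE /= -[p in (p %| _)%N]expn1.
  by rewrite -(residue_eq0 x (n := n.+1)) // x1.
have cy : padic_compat p (fun n => x n.+1 %/ p%:Z)%Z.
  move=> n; apply/eqP; rewrite eqz_mod_dvd -(dvdz_mul2l p0).
  by rewrite mulrBr -!px -PoszM -expnS -eqz_mod_dvd residueS residue_mod.
exists (padic_reduce p_pr cy); apply: padicP => n.
rewrite padic_mulE residue_nat modzMml -modzMmr padic_reduceE modzMmr -px.
by rewrite residueS residue_mod.
Qed.

(** A nonzero residue modulo p^n bounds how often p can be divided out, hence the induction on n. *)
Lemma padic_factor (x : Zp) : x != 0 ->
  exists n (u : Zp), u \is a GRing.unit /\ x = p%:R ^+ n * u.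
Proof.
move=> /padic_neq0[n]; elim: n x => [|n IH] x xn.
  by move: xn; rewrite -residue_mod expn0 modz1.
have [ux|] := boolP (x \is a GRing.unit); first by exists 0%N, x; rewrite mul1r.
rewrite padic_unitE negbK => /eqP /padic_divp[y xy].
have [|m [u [uu yu]]] := IH y.
  apply: contraNneq xn => yn0; rewrite xy -residue_mod padic_mulE residue_nat.
  rewrite modzMml; apply/eqP/dvdz_mod0P.
  by rewrite expnS PoszM dvdz_mul //; apply/dvdz_mod0P; rewrite residueS.
by exists m.+1, u; rewrite exprS -mulrA -yu.
Qed.

Lemma padic_valuation (z : Qp) :
  (exists t : Zp, z = t%:F) \/ (exists t : Zp, z^-1 = t%:F).
Proof.
have [a [b [b0 ab]]] := tofrac_surj z.
have [a0|a0] := eqVneq a 0.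
  left; exists 0; move: ab; rewrite a0 tofrac0 => /eqP; rewrite mulf_eq0.
  by rewrite tofrac_eq0 (negbTE b0) orbF => /eqP.
have [m [u [uu aE]]] := padic_factor a0.
have [n [v [vu bE]]] := padic_factor b0.
apply: (pivot_fraction _ (padic_p_neq0 p_pr) uu vu aE bE ab).
by move=> x y /eqP; rewrite tofrac_eq => /eqP.
Qed.

End PadicValuation.

(** * The Cartan decomposition *)

Lemma ord2_cases (i : 'I_2) : i = 0 \/ i = 1.
Proof. by case: i => [[|[|//]] hi]; [left | right]; exact: val_inj. Qed.

Section Mx2.
Variable F : comUnitRingType.

Definition mx2 (a b c d : F) : 'M[F]_2 := \matrix_(i, j)
  if i == 0 then if j == 0 then a else b else if j == 0 then c else d.

Lemma mx2_eq (A B : 'M[F]_2) : A 0 0 = B 0 0 -> A 0 1 = B 0 1 ->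
  A 1 0 = B 1 0 -> A 1 1 = B 1 1 -> A = B.
Proof.
move=> e00 e01 e10 e11; apply/matrixP => i j.
by case: (ord2_cases i) => ->; case: (ord2_cases j) => ->.
Qed.

Lemma mx2_entries (A : 'M[F]_2) : A = mx2 (A 0 0) (A 0 1) (A 1 0) (A 1 1).
Proof. by apply: mx2_eq; rewrite !mxE. Qed.

Lemma mul_mx2 a b c d a' b' c' d' : mx2 a b c d *m mx2 a' b' c' d' =
  mx2 (a * a' + b * c') (a * b' + b * d') (c * a' + d * c') (c * b' + d * d').
Proof.
by apply: mx2_eq; rewrite !mxE big_ord_recl big_ord1 !mxE.
Qed.

Lemma scale_mx2 k a b c d :
  k *: mx2 a b c d = mx2 (k * a) (k * b) (k * c) (k * d).
Proof. by apply: mx2_eq; rewrite !mxE. Qed.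

Lemma unit_mx2 a b c d :
  (mx2 a b c d \in unitmx) = (a * d - b * c \is a GRing.unit).
Proof.
rewrite unitmxE (expand_det_row _ ord0) big_ord_recl big_ord1 /cofactor.
by rewrite !det_mx11 !mxE /= expr0 expr1 mul1r mulN1r mulrN.
Qed.

End Mx2.

Lemma map_mx2 (A F : comUnitRingType) (f : {rmorphism A -> F}) a b c d :
  map_mx f (mx2 a b c d) = mx2 (f a) (f b) (f c) (f d).
Proof. by apply: mx2_eq; rewrite !mxE. Qed.

Lemma mul_unitmx (F : comUnitRingType) n (M N : 'M[F]_n) :
  M \in unitmx -> N \in unitmx -> M *m N \in unitmx.
Proof. by rewrite unitmx_mul => ->. Qed.

(** Gaussian elimination with pivot 1; the Schur complement d - bc is split into a power of p and a
    factor u, absorbed on the right. *)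
Lemma mx2_LDU (F : comUnitRingType) (b c d p u : F) n :
    d - b * c = p ^+ n * u ->
  mx2 1 b c d =
    mx2 1 0 c 1 *m mx2 1 0 0 (p ^+ n) *m (mx2 1 0 0 u *m mx2 1 b 0 1).
Proof.
move=> /(canRL (subrK _)) ->; rewrite !mul_mx2; congr mx2; ring.
Qed.

Lemma mx2_pivot (F : fieldType) (M : 'M[F]_2) (b c d : F) : M \in unitmx ->
    M 0 1 = b * M 0 0 -> M 1 0 = c * M 0 0 -> M 1 1 = d * M 0 0 ->
  [/\ M 0 0 != 0, M = M 0 0 *: mx2 1 b c d & mx2 1 b c d \in unitmx].
Proof.
move=> uM eb ec ed.
have ME : M = M 0 0 *: mx2 1 b c d.
  by rewrite scale_mx2 {1}[M]mx2_entries mulr1 eb ec ed !(mulrC (M 0 0)).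
have M00 : M 0 0 != 0.
  by apply: contraTneq uM => M0; rewrite ME M0 scale0r unitmxE det0 unitr0.
by split=> //; move: uM; rewrite ME unitmxZ ?unitfE.
Qed.

Section PGL.
Variable F : fieldType.

(** The class of [M], with the identity as default value when [M] is singular. *)
Definition pgl (M : 'M[F]_2) : PGL2 F := \pi_(PGL2 F) (insubd (GL2_one F) M).

Lemma pgl_unit M (uM : M \in unitmx) : pgl M = \pi_(PGL2 F) (MkGL2 uM).
Proof.
by congr (\pi_(PGL2 F) _); apply: val_inj; rewrite /= insubdK.
Qed.

Lemma pgl_surj (g : PGL2 F) : exists2 M, M \in unitmx & g = pgl M.
Proof.
elim/quotW: g => -[M uM]; exists M => //; exact: esym (pgl_unit uM).
Qed.

Lemma pglM M N : M \in unitmx -> N \in unitmx ->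
  pgl (M *m N) = (pgl M * pgl N)%g.
Proof.
move=> uM uN; have uMN : M *m N \in unitmx by rewrite unitmx_mul uM.
rewrite !pgl_unit [RHS]PGL2_mul_pi; congr (\pi_(PGL2 F) _); exact: val_inj.
Qed.

Lemma pglZ c M : c != 0 -> M \in unitmx -> pgl (c *: M) = pgl M.
Proof.
move=> c0 uM; have ucM : c *: M \in unitmx by rewrite unitmxZ ?unitfE.
by rewrite !pgl_unit; apply: (PGL2_eq c0).
Qed.

Lemma pgl1 : pgl 1%:M = 1%g.
Proof.
rewrite (pgl_unit (unitmx1 _ _)); congr (\pi_(PGL2 F) _); exact: val_inj.
Qed.

Lemma pgl_LDU (b c d p u : F) n : p != 0 -> u != 0 -> d - b * c = p ^+ n * u ->
  pgl (mx2 1 b c d) = (pgl (mx2 1 0 c 1) * pgl (mx2 1 0 0 (p ^+ n)) *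
                       (pgl (mx2 1 0 0 u) * pgl (mx2 1 b 0 1)))%g.
Proof.
move=> p0 u0 /mx2_LDU ->; have pn0 : p ^+ n != 0 by rewrite expf_neq0.
by rewrite -!pglM ?mul_unitmx // unit_mx2 unitfE ?mulr0 ?mul0r mul1r subr0
  ?oner_neq0.
Qed.

End PGL.

Section PGLAction.
Variables (q : nat) (q_pr : prime q).
Local Notation Zq := (padic_int q_pr).
Local Notation Qq := (padic q_pr).
Local Notation G := (PGL2 Qq).
Local Notation o := (origin q_pr).
Local Notation std := (std_ray q_pr).
Local Notation tofrac := (@FracField.tofrac Zq).
Local Notation "x %:F" := (FracField.tofrac (x : Zq) : Qq).

Lemma vact_pgl_origin M (uM : M \in unitmx) :
  exists2 L : lattice q_pr, (L : set _) = lattice_span M &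
    vact (pgl M) o = \pi_(vertex q_pr) L.
Proof.
exists (lattice_act (MkGL2 uM) (std_lattice q_pr 0)).
  rewrite -[LHS]/[set M *m v | v in (std_lattice q_pr 0 : set _)].
  by rewrite std_lattice0 image_comp.
by rewrite (pgl_unit uM) vact_pi.
Qed.

Lemma vact_transitive (v : vertex q_pr) : exists g : G, v = vact g o.
Proof.
elim/quotW: v => L; have [B uB LB] : exists2 B, B \in unitmx &
  (L : set _) = lattice_span B by case: L.
exists (pgl B); have [L' L'B ->] := vact_pgl_origin uB.
by congr (\pi_(vertex q_pr) _); apply: lattice_eq; rewrite LB L'B.
Qed.

Lemma std_mx2 n : std_lattice_mx q_pr n = mx2 1 0 0 (q%:R ^+ n).
Proof. by apply: mx2_eq; rewrite !mxE. Qed.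

Definition Dn n : G := pgl (mx2 1 0 0 (q%:R ^+ n)).

Lemma qF_neq0 n : (q%:R ^+ n : Qq) != 0.
Proof. by rewrite expf_neq0 // -tofrac_nat tofrac_eq0 padic_p_neq0. Qed.

Lemma Dn_unit n : (mx2 1 0 0 (q%:R ^+ n) : 'M[Qq]_2) \in unitmx.
Proof. by rewrite unit_mx2 mul1r mul0r subr0 unitfE qF_neq0. Qed.

Lemma vact_Dn n : vact (Dn n) o = std n.
Proof.
have [L LE ->] := vact_pgl_origin (Dn_unit n).
by congr (\pi_(vertex q_pr) _); apply: lattice_eq; rewrite LE /= std_mx2.
Qed.

(** An element of GL2(Zq) maps Zq^2 onto itself. *)
Lemma origin_stab_int (M : 'M[Zq]_2) : M \in unitmx ->
  origin_stab (pgl (map_mx tofrac M)).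
Proof.
move=> uM; have uM' : map_mx tofrac M \in unitmx.
  by rewrite unitmxE det_map_mx rmorph_unit // -unitmxE.
rewrite /origin_stab /=; have [L LE ->] := vact_pgl_origin uM'.
congr (\pi_(vertex q_pr) _); apply: lattice_eq; rewrite LE std_lattice0.
apply/seteqP; split=> _ [w _ <-].
  by exists (M *m w); rewrite ?map_mxM.
by exists (invmx M *m w); rewrite // -map_mxM mulKVmx.
Qed.

Lemma origin_stabM (g h : G) :
  origin_stab g -> origin_stab h -> origin_stab (g * h)%g.
Proof. by rewrite /origin_stab /= => go ho; rewrite vactM ho. Qed.

Definition Kmx (a b c d : Zq) : G := pgl (mx2 a%:F b%:F c%:F d%:F).

Local Arguments Kmx (a b c d)%_ring_scope.

Lemma Kmx_stab a b c d : a * d - b * c \is a GRing.unit ->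
  origin_stab (Kmx a b c d).
Proof.
by move=> u; rewrite /Kmx -map_mx2; apply: origin_stab_int; rewrite unit_mx2.
Qed.

Definition swap : G := Kmx 0 1 1 0.

Lemma swap_det : (0 : Zq) * 0 - 1 * 1 \is a GRing.unit.
Proof. by rewrite mul0r mul1r sub0r unitrN unitr1. Qed.

Lemma swap_stab : origin_stab swap.
Proof. exact/Kmx_stab/swap_det. Qed.

(** Scaling the top left entry to 1 is free in PGL2 and leaves integral entries; in the LDU
    factorization the triangular factors and diag(1, u) then lie in K. *)
Lemma cartan_pivot (M : 'M[Qq]_2) : M \in unitmx ->
    (forall i j, exists t : Zq, M i j = t%:F * M 0 0) ->
  exists n (k k' : G),
    [/\ origin_stab k, origin_stab k' & pgl M = (k * Dn n * k')%g].
Proof.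
move=> uM dv; have [[[b bE] [c cE]] [d dE]] := (dv 0 1, dv 1 0, dv 1 1).
have [M00 -> uM1] := mx2_pivot uM bE cE dE; rewrite (pglZ M00 uM1).
have /padic_factor[n [u [uu dbE]]] : d - b * c != 0.
  move: uM1; rewrite unit_mx2 unitfE mul1r -tofracM -tofracB tofrac_eq0.
  by [].
have u1 : 1 * 1 - 0 * c \is a GRing.unit by rewrite mul1r mul0r subr0 unitr1.
have u2 : 1 * u - 0 * 0 \is a GRing.unit by rewrite mul1r mul0r subr0.
have u3 : 1 * 1 - b * 0 \is a GRing.unit by rewrite mul1r mulr0 subr0 unitr1.
exists n, (Kmx 1 0 c 1), (Kmx 1 0 0 u * Kmx 1 b 0 1)%g; split.
- exact: Kmx_stab.
- by apply: origin_stabM; exact: Kmx_stab.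
rewrite /Kmx !tofrac0 !tofrac1; apply: pgl_LDU.
- by have := qF_neq0 1.
- by rewrite tofrac_eq0; apply: contraTneq uu => ->; rewrite unitr0.
- by rewrite -tofracM -tofracB dbE tofracM tofracXn tofrac_nat.
Qed.

End PGLAction.

Arguments Kmx {q q_pr} (a b c d)%_ring_scope.

Section PGLSwap.
Variable F : fieldType.
Implicit Types a b c d : F.

Lemma pgl_swapl a b c d : mx2 a b c d \in unitmx ->
  mx2 c d a b \in unitmx /\
  pgl (mx2 a b c d) = (pgl (mx2 0 1 1 0) * pgl (mx2 c d a b))%g.
Proof.
rewrite !unit_mx2 !unitfE => u.
have u' : c * b - d * a != 0.
  by rewrite -opprB oppr_eq0 [d * a]mulrC [c * b]mulrC.
split=> //; rewrite -pglM ?unit_mx2 ?unitfE //.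
  by rewrite mul_mx2 !mul0r !mul1r !add0r !addr0.
by rewrite mul0r mul1r sub0r oppr_eq0 oner_neq0.
Qed.

Lemma pgl_swapr a b c d : mx2 a b c d \in unitmx ->
  mx2 b a d c \in unitmx /\
  pgl (mx2 a b c d) = (pgl (mx2 b a d c) * pgl (mx2 0 1 1 0))%g.
Proof.
rewrite !unit_mx2 !unitfE => u.
have u' : b * c - a * d != 0 by rewrite -opprB oppr_eq0.
split=> //; rewrite -pglM ?unit_mx2 ?unitfE //.
  by rewrite mul_mx2 !mulr0 !mulr1 !add0r !addr0.
by rewrite mul0r mul1r sub0r oppr_eq0 oner_neq0.
Qed.

(** Conjugation by diag(1, p^n) multiplies the lower left entry by p^n. *)
Lemma pgl_diag_lower (p c : F) n : p != 0 ->
  (pgl (mx2 1 0 0 (p ^+ n)) * pgl (mx2 1 0 c 1) * pgl (mx2 1 0 0 (p ^+ 1)))%g =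
  (pgl (mx2 1 0 (p ^+ n * c) 1) * pgl (mx2 1 0 0 (p ^+ n.+1)))%g.
Proof.
move=> p0; have pn0 m : p ^+ m != 0 by rewrite expf_neq0.
rewrite -!pglM ?mul_unitmx // ?unit_mx2 ?unitfE ?mulr0 ?mul0r ?mul1r ?subr0
  ?oner_neq0 //.
by rewrite !mul_mx2 expr1 [p ^+ n.+1]exprS; congr (pgl (mx2 _ _ _ _)); ring.
Qed.

(** The two matrices differ by the scalar p, which is trivial in PGL2. This is the computation
    behind the one backward neighbour. *)
Lemma pgl_diag_swap (p : F) n : p != 0 ->
  (pgl (mx2 1 0 0 (p ^+ n.+1)) * pgl (mx2 0 1 1 0) *
    pgl (mx2 1 0 0 (p ^+ 1)))%g =
  (pgl (mx2 1 0 0 (p ^+ n)) * pgl (mx2 0 1 1 0))%g.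
Proof.
move=> p0; have pn0 m : p ^+ m != 0 by rewrite expf_neq0.
have uS : (mx2 0 1 1 0 : 'M[F]_2) \in unitmx.
  by rewrite unit_mx2 unitfE mul0r mul1r sub0r oppr_eq0 oner_neq0.
have uD m : mx2 1 0 0 (p ^+ m) \in unitmx.
  by rewrite unit_mx2 unitfE mul0r mul1r subr0.
rewrite -!pglM ?mul_unitmx // -[in RHS](pglZ p0) ?mul_unitmx //.
rewrite !mul_mx2 scale_mx2 expr1 [p ^+ n.+1]exprS.
by congr (pgl (mx2 _ _ _ _)); ring.
Qed.

Lemma pgl_lower_diag (p c : F) : p != 0 -> mx2 1 0 c p \in unitmx /\
  (pgl (mx2 1 0 c 1) * pgl (mx2 1 0 0 (p ^+ 1)))%g = pgl (mx2 1 0 c p).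
Proof.
move=> p0; rewrite expr1 -pglM ?unit_mx2 ?unitfE ?mulr0 ?mul0r ?mul1r ?subr0
  ?oner_neq0 //.
by split=> //; rewrite mul_mx2; congr (pgl (mx2 _ _ _ _)); ring.
Qed.

Lemma pgl_swap_diag (p : F) : p != 0 -> mx2 0 p 1 0 \in unitmx /\
  (pgl (mx2 0 1 1 0) * pgl (mx2 1 0 0 (p ^+ 1)))%g = pgl (mx2 0 p 1 0).
Proof.
move=> p0; rewrite expr1 -pglM ?unit_mx2 ?unitfE ?mulr0 ?mul0r ?mulr1 ?mul1r
  ?subr0 //.
  rewrite sub0r oppr_eq0; split=> //; rewrite mul_mx2.
  by congr (pgl (mx2 _ _ _ _)); ring.
by rewrite sub0r oppr_eq0 oner_neq0.
Qed.

End PGLSwap.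

Lemma mem_seq4 (T : eqType) (a b c d : T) (s := [:: a; b; c; d]) :
  [/\ a \in s, b \in s, c \in s & d \in s].
Proof. by rewrite !inE !eqxx !orbT. Qed.

Section Cartan.
Variables (q : nat) (q_pr : prime q).
Local Notation Zq := (padic_int q_pr).
Local Notation Qq := (padic q_pr).
Local Notation G := (PGL2 Qq).
Local Notation std := (std_ray q_pr).
Local Notation "x %:F" := (FracField.tofrac (x : Zq) : Qq).
Local Notation D := (Dn q_pr).

(** This is |y| <= |x| for the q-adic absolute value, a total preorder since Zq is a valuation
    ring. *)
Definition dominates (x y : Qq) := exists t : Zq, y = t%:F * x.

Lemma dominates_trans x y z : dominates x y -> dominates y z -> dominates x z.
Proof. by move=> [t ->] [s ->]; exists (s * t); rewrite tofracM mulrA. Qed.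

Lemma dominates_total x y : dominates x y \/ dominates y x.
Proof.
have [->|x0] := eqVneq x 0; first by right; exists 0; rewrite tofrac0 mul0r.
have [->|y0] := eqVneq y 0; first by left; exists 0; rewrite tofrac0 mul0r.
have [[t e]|[t e]] := padic_valuation (y / x); [left|right]; exists t.
  by rewrite -e divfK.
by rewrite -e invf_div divfK.
Qed.

Lemma dominates_min x (s : seq Qq) :
  exists2 m, m \in x :: s & forall y, y \in x :: s -> dominates m y.
Proof.
have refl z : dominates z z by exists 1; rewrite tofrac1 mul1r.
elim: s => [|y s [m ms mmin]].
  by exists x; rewrite ?mem_seq1 // => y; rewrite mem_seq1 => /eqP ->.
have [my|ym] := dominates_total m y.
  exists m; first by move: ms; rewrite !inE => /orP[->|->]; rewrite ?orbT.
  move=> z; rewrite inE => /orP[/eqP->|].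
    by apply: mmin; rewrite mem_head.
  rewrite inE => /orP[/eqP-> //|zs]; apply: mmin.
  by rewrite inE zs orbT.
exists y; first by rewrite !inE eqxx orbT.
move=> z; rewrite inE => /orP[/eqP->|].
  by apply: dominates_trans ym _; apply: mmin; rewrite mem_head.
rewrite inE => /orP[/eqP-> //|zs]; apply: dominates_trans ym _.
by apply: mmin; rewrite inE zs orbT.
Qed.

Lemma swapE : swap q_pr = pgl (mx2 0 1 1 0).
Proof. by rewrite /swap /Kmx tofrac0 tofrac1. Qed.

Definition has_cartan (g : G) := exists n (k k' : G),
  [/\ origin_stab k, origin_stab k' & g = (k * D n * k')%g].

Lemma has_cartanl k g : origin_stab k -> has_cartan g -> has_cartan (k * g)%g.
Proof.
move=> Kk [n [h [h' [Kh Kh' ->]]]]; exists n, (k * h)%g, h'.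
by split=> //; [exact: origin_stabM | rewrite !mulgA].
Qed.

Lemma has_cartanr k g : origin_stab k -> has_cartan g -> has_cartan (g * k)%g.
Proof.
move=> Kk [n [h [h' [Kh Kh' ->]]]]; exists n, h, (h' * k)%g.
by split=> //; [exact: origin_stabM | rewrite !mulgA].
Qed.

Lemma cartan_mx2 a b c d : mx2 a b c d \in unitmx ->
  dominates a b -> dominates a c -> dominates a d ->
  has_cartan (pgl (mx2 a b c d)).
Proof.
move=> uM ab ac ad; apply: cartan_pivot => // i j; rewrite ![_ 0 0]mxE /=.
case: (ord2_cases i) => ->; case: (ord2_cases j) => ->; rewrite mxE //=.
by exists 1; rewrite tofrac1 mul1r.
Qed.

(** An entry of largest absolute value is brought to the top left corner by swapping rows and
    columns; the swap lies in K, so [cartan_pivot] concludes. *)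
Lemma cartan (g : G) : has_cartan g.
Proof.
have [M uM ->] := pgl_surj g; move: uM; rewrite [M]mx2_entries.
set a := M 0 0; set b := M 0 1; set c := M 1 0; set d := M 1 1 => uM.
have [m + mmin] := dominates_min a [:: b; c; d].
have [ma mb mc md] :
    [/\ dominates m a, dominates m b, dominates m c & dominates m d].
  have [ha hb hc hd] := mem_seq4 a b c d.
  by split; [apply: mmin ha | apply: mmin hb | apply: mmin hc | apply: mmin hd].
rewrite !inE => /or4P[] /eqP e; rewrite e in ma mb mc md.
- exact: cartan_mx2.
- have [uN ->] := pgl_swapr uM; rewrite -swapE; apply: has_cartanr.
    exact: swap_stab.
  exact: cartan_mx2.
- have [uN ->] := pgl_swapl uM; rewrite -swapE; apply: has_cartanl.
    exact: swap_stab.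
  exact: cartan_mx2.
- have [uN ->] := pgl_swapl uM; rewrite -swapE; apply: has_cartanl.
    exact: swap_stab.
  have [uN' ->] := pgl_swapr uN; rewrite -swapE; apply: has_cartanr.
    exact: swap_stab.
  exact: cartan_mx2.
Qed.

Lemma vertex_cartan v : exists n (k : G), origin_stab k /\ v = vact k (std n).
Proof.
have [g ->] := vact_transitive v; have [n [k [k' [Kk Kk' ->]]]] := cartan g.
by exists n, k; split=> //; rewrite !vactM Kk' vact_Dn.
Qed.

End Cartan.

(** * Neighbours and distances in the tree *)

Section Col2.
Variable F : comNzRingType.

Definition col2 (x y : F) : 'cV[F]_2 := \col_i (if i == 0 then x else y).

Lemma col2_eq (u v : 'cV[F]_2) : u 0 0 = v 0 0 -> u 1 0 = v 1 0 -> u = v.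
Proof. by move=> e0 e1; apply/colP => i; case: (ord2_cases i) => ->. Qed.

Lemma col2_entries (u : 'cV[F]_2) : u = col2 (u 0 0) (u 1 0).
Proof. by apply: col2_eq; rewrite !mxE. Qed.

Lemma scale_col2 a x y : a *: col2 x y = col2 (a * x) (a * y).
Proof. by apply: col2_eq; rewrite !mxE. Qed.

Lemma add_col2 x y x' y' : col2 x y + col2 x' y' = col2 (x + x') (y + y').
Proof. by apply: col2_eq; rewrite !mxE. Qed.

End Col2.

Lemma mulmx_col2 (F : comUnitRingType) (a b c d x y : F) :
  mx2 a b c d *m col2 x y = col2 (a * x + b * y) (c * x + d * y).
Proof.
by apply: col2_eq; rewrite !mxE big_ord_recl big_ord1 !mxE.
Qed.

Lemma map_col2 (A F : comNzRingType) (f : {rmorphism A -> F}) x y :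
  map_mx f (col2 x y) = col2 (f x) (f y).
Proof. by apply: col2_eq; rewrite !mxE. Qed.

Section Neighbours.
Variables (q : nat) (q_pr : prime q).
Local Notation Zq := (padic_int q_pr).
Local Notation Qq := (padic q_pr).
Local Notation "x %:F" := (FracField.tofrac (x : Zq) : Qq).

Lemma padic_mod (x : Zq) :
  exists2 c, (c < q)%N & exists t : Zq, x = c%:R + q%:R * t.
Proof.
have q0 : (0 : int) < q%:Z by rewrite ltz_nat prime_gt0.
have xq := residue_mod x 1; rewrite expn1 in xq.
have [x0 xlt] : 0 <= x 1%N /\ x 1%N < q%:Z.
  by rewrite -xq modz_ge0 ?ltz_pmod //; case: q q0.
exists `|x 1%N|%N; first by rewrite -ltz_nat gez0_abs.
have /padic_divp[t e] : (x - `|x 1%N|%:R) 1%N = 0.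
  rewrite -residue_mod padic_subE residue_nat gez0_abs // expn1.
  by rewrite xq subrr mod0z.
by exists t; rewrite -e subrKC.
Qed.

Lemma padic_unit_or_div (x : Zq) :
  x \is a GRing.unit \/ exists t : Zq, x = q%:R * t.
Proof.
rewrite padic_unitE; have [/padic_divp|] := eqVneq (x 1%N) 0; first by right.
by left.
Qed.

(** Modulo q, [Q] is a proper nonzero subspace of the plane over F_q, that is, one of the q + 1
    lines: of slope c, or vertical. *)
Lemma submodule_between (Q : Zq -> Zq -> Prop) :
    (forall a b a' b', Q a b -> Q a' b' -> Q (a + a') (b + b')) ->
    (forall t a b, Q a b -> Q (t * a) (t * b)) ->
    (forall a b, Q (q%:R * a) (q%:R * b)) ->
    ~ (forall a b, Q a b) ->
    (exists a b, Q a b /\ ~ (exists t s : Zq, a = q%:R * t /\ b = q%:R * s)) ->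
  (exists2 c, (c < q)%N &
     forall a b, Q a b <-> exists t : Zq, b = c%:R * a + q%:R * t) \/
  (forall a b, Q a b <-> exists t : Zq, a = q%:R * t).
Proof.
move=> Qadd Qscale qQ notQ [a [b [Qab nab]]].
have [ua|[a' aE]] := padic_unit_or_div a; [left|right].
- have [c cq [t cE]] := padic_mod (b / a); exists c => //.
  have Q1c : Q 1 c%:R.
    have := Qadd _ _ _ _ (Qscale a^-1 _ _ Qab) (qQ 0 (- t)).
    by rewrite mulVr // mulr0 addr0 [a^-1 * b]mulrC cE mulrN addrK.
  move=> x y; split=> [Qxy|[s ->]]; last first.
    have := Qadd _ _ _ _ (Qscale x _ _ Q1c) (qQ 0 s).
    by rewrite mulr0 addr0 mulr1 mulrC.
  have [uz|[s zE]] := padic_unit_or_div (y - c%:R * x); last first.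
    by exists s; rewrite -zE subrKC.
  exfalso; apply: notQ => x' y'.
  (* A point off the line of slope c, corrected by a multiple of (1, c), yields (0, 1), and [Q]
     would be everything. *)
  have Q01 : Q 0 1.
    have := Qscale (y - c%:R * x)^-1 _ _
      (Qadd _ _ _ _ Qxy (Qscale (- x) _ _ Q1c)).
    by rewrite mulr1 subrr mulr0 mulNr [x * _]mulrC mulVr.
  have := Qadd _ _ _ _ (Qscale x' _ _ Q1c) (Qscale (y' - x' * c%:R) _ _ Q01).
  by rewrite mulr0 addr0 !mulr1 subrKC.
- have ub : b \is a GRing.unit.
    have [//|[b' bE]] := padic_unit_or_div b.
    by case: nab; exists a', b'.
  have Q01 : Q 0 1.
    have := Qscale b^-1 _ _ (Qadd _ _ _ _ Qab (qQ (- a') 0)).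
    by rewrite mulr0 addr0 mulrN aE subrr mulr0 mulVr.
  move=> x y; split=> [Qxy|[s ->]]; last first.
    have := Qadd _ _ _ _ (qQ s 0) (Qscale y _ _ Q01).
    by rewrite !mulr0 addr0 mulr1 add0r.
  have [ux|//] := padic_unit_or_div x.
  exfalso; apply: notQ => x' y'.
  have Q10 : Q 1 0.
    have := Qscale x^-1 _ _ (Qadd _ _ _ _ Qxy (Qscale (- y) _ _ Q01)).
    by rewrite mulr0 addr0 mulr1 subrr mulr0 mulVr.
  have := Qadd _ _ _ _ (Qscale x' _ _ Q10) (Qscale y' _ _ Q01).
  by rewrite !mulr0 !mulr1 addr0 add0r.
Qed.

Lemma lattice_add (L : lattice q_pr) u v :
  (L : set _) u -> (L : set _) v -> (L : set _) (u + v).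
Proof.
case: L => /= _ [B _ ->] [w _ <-] [w' _ <-].
by exists (w + w') => //; rewrite map_mxD mulmxDr.
Qed.

Lemma lattice_scaleZ (L : lattice q_pr) (t : Zq) u :
  (L : set _) u -> (L : set _) (t%:F *: u).
Proof.
case: L => /= _ [B _ ->] [w _ <-].
by exists (t *: w) => //; rewrite map_mxZ scalemxAr.
Qed.

Lemma lattice_span2 (a b c d : Qq) u : lattice_span (mx2 a b c d) u <->
  exists x y : Zq, u = col2 (a * x%:F + b * y%:F) (c * x%:F + d * y%:F).
Proof.
split=> [[w _ <-]|[x [y ->]]].
  exists (w 0 0), (w 1 0).
  by rewrite [in LHS](col2_entries w) map_col2 mulmx_col2.
by exists (col2 x y) => //; rewrite map_col2 mulmx_col2.
Qed.

End Neighbours.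

Section AdjacentOrigin.
Variables (q : nat) (q_pr : prime q).
Local Notation Zq := (padic_int q_pr).
Local Notation Qq := (padic q_pr).
Local Notation o := (origin q_pr).
Local Notation std := (std_ray q_pr).
Local Notation "x %:F" := (FracField.tofrac (x : Zq) : Qq).

Lemma std_lattice0P u : (std_lattice q_pr 0 : set _) u <->
  exists a b : Zq, u = col2 a%:F b%:F.
Proof.
rewrite std_lattice0; split=> [[w _ <-]|[a [b ->]]].
  by exists (w 0 0), (w 1 0); rewrite [in LHS](col2_entries w) map_col2.
by exists (col2 a b); rewrite // map_col2.
Qed.

Lemma q_neq0 : (q%:R : Qq) != 0.
Proof. by have := qF_neq0 q_pr 1; rewrite expr1. Qed.

Lemma vertex_scale (c : Qq) (L L' : lattice q_pr) : c != 0 ->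
  (forall u, (L : set _) u <-> exists2 v, (L' : set _) v & u = c *: v) ->
  \pi_(vertex q_pr) L = \pi_(vertex q_pr) L'.
Proof.
move=> c0 LL'; apply: (vertex_eq c0); apply/seteqP; split=> u.
  by move=> /LL'[v L'v ->]; exists v.
by move=> [v L'v <-]; apply/LL'; exists v.
Qed.

(** Lattices strictly between qL and L correspond to lines modulo q. Slope c gives the columns (1,
    c), (0, q); the vertical line gives (0, 1), (q, 0). *)
Lemma adjacent_origin w : Defs.adjacent o w ->
  (exists2 c, (c < q)%N & w = vact (Kmx 1 0 c%:R 1) (std 1)) \/
  w = vact (swap q_pr) (std 1).
Proof.
move=> [_ [L [L' [Lo <- [qL nqL] [L'L nL'L]]]]].
have [c c0 LE] := vertex_repr Lo.
have LP u : (L : set _) u <-> exists a b : Zq, u = c *: col2 a%:F b%:F.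
  rewrite LE; split=> [[v /std_lattice0P[a [b ->]] <-]|[a [b ->]]].
    by exists a, b.
  by exists (col2 a%:F b%:F) => //; apply/std_lattice0P; exists a, b.
pose Q a b := (L' : set _) (c *: col2 a%:F b%:F).
have L'P u : (L' : set _) u -> exists a b, Q a b /\ u = c *: col2 a%:F b%:F.
  by move=> L'u; have /LP[a [b e]] := L'L _ L'u; exists a, b; rewrite /Q -e.
have cinj u v : c *: u = c *: v -> u = v :> 'cV[Qq]_2 by exact: scalerI.
case: (@submodule_between q q_pr Q).
- move=> a b a' b' Qab Qab'; rewrite /Q !tofracD -add_col2 scalerDr.
  exact: lattice_add.
- move=> t a b Qab; rewrite /Q !tofracM -scale_col2 scalerA mulrC -scalerA.
  exact: lattice_scaleZ.
- move=> a b; apply: qL; exists (c *: col2 a%:F b%:F).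
    by apply/LP; exists a, b.
  by rewrite !tofracM tofrac_nat -scale_col2 !scalerA mulrC.
- by move=> Qall; apply: nL'L => u /LP[a [b ->]]; exact: Qall.
- apply: contrapT => nQ; apply: nqL => u /L'P[a [b [Qab ->]]].
  apply: contrapT => nu; apply: nQ; exists a, b; split=> //.
  move=> [t [s [aE bE]]]; apply: nu; exists (c *: col2 t%:F s%:F).
    by apply/LP; exists t, s.
  by rewrite aE bE !tofracM tofrac_nat -scale_col2 !scalerA mulrC.
- move=> [r rq QE]; left; exists r => //.
  have [uM ME] := pgl_lower_diag (r%:R : Qq) q_neq0.
  rewrite -vact_Dn -vactM /Kmx /Dn tofrac1 tofrac0 tofrac_nat ME.
  have [L1 L1E ->] := vact_pgl_origin uM.
  apply: (vertex_scale c0) => u; rewrite L1E.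
  split=> [/L'P[a [b [/QE[t ->] ->]]]|[v /lattice_span2[x [y ->]] ->]].
    exists (col2 a%:F (r%:R * a + q%:R * t)%:F) => //; apply/lattice_span2.
    exists a, t; rewrite tofracD !tofracM !tofrac_nat.
    by rewrite mul1r mul0r addr0.
  have := (QE x (r%:R * x + q%:R * y)).2 (ex_intro _ y erefl).
  rewrite /Q tofracD !tofracM !tofrac_nat.
  by rewrite mul1r mul0r addr0.
- move=> QE; right.
  have [uM ME] := pgl_swap_diag q_neq0.
  rewrite -vact_Dn -vactM swapE /Dn ME.
  have [L1 L1E ->] := vact_pgl_origin uM.
  apply: (vertex_scale c0) => u; rewrite L1E.
  split=> [/L'P[a [b [/QE[t ->] ->]]]|[v /lattice_span2[x [y ->]] ->]].
    exists (col2 (q%:R * t)%:F b%:F) => //; apply/lattice_span2.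
    exists b, t; rewrite !tofracM !tofrac_nat.
    by rewrite mul1r !mul0r addr0 add0r.
  have := (QE (q%:R * y) x).2 (ex_intro _ y erefl).
  rewrite /Q !tofracM !tofrac_nat.
  by rewrite mul1r !mul0r addr0 add0r.
Qed.

End AdjacentOrigin.

Section TreeDistance.
Variables (q : nat) (q_pr : prime q).
Local Notation Zq := (padic_int q_pr).
Local Notation Qq := (padic q_pr).
Local Notation G := (PGL2 Qq).
Local Notation vertex := (vertex q_pr).
Local Notation o := (origin q_pr).
Local Notation std := (std_ray q_pr).
Local Notation adj := (@Defs.adjacent q q_pr).
Local Notation walk := (@Defs.walk q q_pr).
Local Notation tdist := (@Defs.tdist q q_pr).
Local Notation D := (Dn q_pr).
Implicit Types (u v w : vertex) (a b d f g k : G).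

(** What the unipotent element of slope c becomes when moved to the left of [D n]. *)
Definition lower n (c : nat) : G := Kmx 1 0 (q%:R ^+ n * c%:R : Zq) 1.

Lemma lower_stab n c : origin_stab (lower n c).
Proof. by apply: Kmx_stab; rewrite mul1r mul0r subr0 unitr1. Qed.

Lemma vactKV g : cancel (vact g^-1%g) (vact g).
Proof. by move=> v; rewrite -vactM mulgV vact1. Qed.

Lemma lower_diag n c :
  (D n * Kmx 1 0 c%:R 1 * D 1)%g = (lower n c * D n.+1)%g.
Proof.
rewrite /lower /Kmx /Dn tofrac1 tofrac0 tofracM tofracXn !tofrac_nat.
exact: pgl_diag_lower (q_neq0 q_pr).
Qed.

Lemma swap_diag n : (D n.+1 * swap q_pr * D 1)%g = (D n * swap q_pr)%g.
Proof. rewrite swapE; exact: pgl_diag_swap (q_neq0 q_pr). Qed.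

Lemma Dn0 : D 0 = 1%g.
Proof.
rewrite /Dn expr0 -pgl1; congr (pgl _); apply: mx2_eq; by rewrite !mxE.
Qed.

Lemma vact_shift k a b (c : G) d f v : (a * b * c = d * f)%g ->
  vact (k * a)%g (vact b (vact c v)) = vact (k * d)%g (vact f v).
Proof. by move=> e; rewrite -!vactM -!mulgA (mulgA a) e. Qed.

(** Translation by the inverse of k [D n] reduces to the neighbours of o. Moved back, the slopes
    give the q forward neighbours and the swap gives the backward one. *)
Lemma adjacent_std n k w : adj (vact k (std n)) w ->
  (exists2 c, (c < q)%N & w = vact (k * lower n c)%g (std n.+1)) \/
  w = if n is m.+1 then vact k (std m) else vact (k * swap q_pr)%g (std 1).
Proof.
have q0 := q_neq0 q_pr.
move=> /(adjacent_vact (k * D n)^-1%g).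
rewrite -vact_Dn -[vact k (vact _ _)]vactM vactK => /adjacent_origin.
set w' := vact _ w; have -> : w = vact (k * D n)%g w' by rewrite /w' vactKV.
move=> [[c cq ->]|->]; [left; exists c; [exact: cq|]|right].
  rewrite -(vact_Dn q_pr 1) -(vact_Dn q_pr n.+1).
  exact: vact_shift (lower_diag n c).
(* At the origin there is no backward neighbour: the swap gives the (q + 1)-st vertex at distance
   1. *)
case: n {w'} => [|n]; first by rewrite Dn0 mulg1 [RHS]vactM.
rewrite -(vact_Dn q_pr 1) (vact_shift _ _ (swap_diag n)) swap_stab [LHS]vactM.
by rewrite vact_Dn.
Qed.

(** From qL < L' < L follows qL' < qL < L', and qL is another representative of the class of L. *)
Lemma adjacent_sym v w : adj v w -> adj w v.
Proof.
move=> [vw [L [L' [Lv L'w [qL nqL] [L'L nL'L]]]]]; split; first exact: nesym.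
have q0 := q_neq0 q_pr.
exists L', (lattice_scale L q0); split=> //.
- by rewrite -Lv; apply: (vertex_eq q0).
- split; first exact: image_subset.
  move=> h; apply: nL'L => u Lu.
  have [|u' L'u' /(scalerI q0) <- //] := h (q%:R *: u).
  by exists u.
Qed.

Lemma walk_cat m n u v w : walk m u v -> walk n v w -> walk (m + n) u w.
Proof.
move=> [r [r0 rm rA]] [s [s0 sn sA]].
exists (fun i => if (i <= m)%N then r i else s (i - m)%N); split=> //.
- case: n sn {sA} => [|n] sn; first by rewrite addn0 leqnn rm -s0.
  by rewrite leqNgt addnS ltnS leq_addr /= -sn; congr s; lia.
- move=> i imn; case: (ltngtP i m) => im.
  + exact: rA.
  + by rewrite subSn; [apply: sA; lia | lia].
  + by rewrite im rm -s0 subSnn; apply: sA; lia.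
Qed.

Lemma walk_sym n u v : walk n u v -> walk n v u.
Proof.
move=> [r [r0 rn rA]]; exists (fun i => r (n - i)%N); split.
- by rewrite subn0.
- by rewrite subnn.
- move=> i ni; apply: adjacent_sym; rewrite (_ : (n - i = (n - i.+1).+1)%N).
    by apply: rA; lia.
  by lia.
Qed.

Lemma walk_origin v : exists n, walk n o v.
Proof.
have [n [k [Kk ->]]] := vertex_cartan v; exists n; rewrite -[X in walk _ X _]Kk.
by apply: walk_vact; exists std; split=> // i _; exact: std_adjacent.
Qed.

(** The tree is connected, so the default value in [tdist] is never taken. *)
Lemma tdistP v w : walk (tdist v w) v w /\
  forall m, walk m v w -> (tdist v w <= m)%N.
Proof.
rewrite /Defs.tdist; case: xgetP => [n _ []//|none].
have [m wm] : exists m, walk m v w.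
  have [a wa] := walk_origin v; have [b wb] := walk_origin w.
  by exists (a + b)%N; exact: walk_cat (walk_sym wa) wb.
have ex : exists m, `[< walk m v w >] by exists m; apply/asboolP.
case: (ex_minnP ex) => n /asboolP wn nmin; case: (none n); split=> // k wk.
by apply: nmin; apply/asboolP.
Qed.

Lemma tdist_walk v w : walk (tdist v w) v w.
Proof. by case: (tdistP v w). Qed.

Lemma tdist_le m v w : walk m v w -> (tdist v w <= m)%N.
Proof. by case: (tdistP v w) => _; apply. Qed.

Lemma tdist_sym v w : tdist v w = tdist w v.
Proof.
by apply/eqP; rewrite eqn_leq !tdist_le //; apply: walk_sym; exact: tdist_walk.
Qed.

Lemma tdist_triangle u v w : (tdist u w <= tdist u v + tdist v w)%N.
Proof.
by apply: tdist_le; exact: walk_cat (tdist_walk _ _) (tdist_walk _ _).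
Qed.

Lemma tdistvv v : tdist v v = 0%N.
Proof.
by apply/eqP; rewrite -leqn0; apply: tdist_le; exists (fun=> v); split.
Qed.

Lemma tdist_eq0 v w : tdist v w = 0%N -> v = w.
Proof. by move=> d0; have := tdist_walk v w; rewrite d0 => -[r [<- <- _]]. Qed.

Lemma tdist_origin_std k n : origin_stab k -> tdist o (vact k (std n)) = n.
Proof.
move=> Kk; rewrite -[X in tdist X _]Kk tdist_vact.
by rewrite (std_ray_geodesic q_pr (leq0n n)) subn0.
Qed.

Lemma vertex_polar v : exists2 k, origin_stab k & v = vact k (std (tdist o v)).
Proof.
have [n [k [Kk ->]]] := vertex_cartan v; exists k => //.
by rewrite tdist_origin_std.
Qed.

Lemma adjacent_dist_origin n k w : origin_stab k -> adj (vact k (std n)) w ->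
  tdist o w = n.+1 \/ exists2 m, n = m.+1 & w = vact k (std m).
Proof.
move=> Kk /adjacent_std[[c _ ->]|].
  left; apply: tdist_origin_std; apply: origin_stabM => //.
  exact: lower_stab.
case: n => [|n] ->; last by right; exists n.
left; apply: tdist_origin_std; apply: origin_stabM => //.
exact: swap_stab.
Qed.

Lemma tdist_transfer g v w : tdist (vact g v) w = tdist v (vact g^-1%g w).
Proof. by rewrite -(tdist_vact g^-1%g) vactK. Qed.

(** By transitivity u may be taken to be o, where the list of neighbours shows that the distance
    changes by exactly one. *)
Lemma adjacent_dist u v w : adj v w ->
  tdist u w = (tdist u v).+1 \/ tdist u v = (tdist u w).+1.
Proof.
have [g ->] := vact_transitive u.
move=> /(adjacent_vact g^-1%g); rewrite !tdist_transfer.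
move: (vact _ v) (vact _ w) => {}v {}w; have [k Kk {1}->] := vertex_polar v.
case/(adjacent_dist_origin Kk) => [->|[m -> ->]]; first by left.
by right; rewrite tdist_origin_std.
Qed.

(** This expresses the absence of cycles: again with u = o, every neighbour but one is farther
    away. *)
Lemma closer_unique u v w w' : adj v w -> adj v w' ->
  tdist u v = (tdist u w).+1 -> tdist u v = (tdist u w').+1 -> w = w'.
Proof.
have [g ->] := vact_transitive u.
move=> /(adjacent_vact g^-1%g) + /(adjacent_vact g^-1%g).
rewrite !tdist_transfer => vw vw' dw dw'.
apply: (can_inj (vactK g^-1%g)); move: vw vw' dw dw'.
move: (vact _ v) (vact _ w) (vact _ w') => {}v {}w {}w'.
have [k Kk {1 2}->] := vertex_polar v.
case/(adjacent_dist_origin Kk) => [->|[m dv ->]].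
  by move=> _ e; exfalso; lia.
case/(adjacent_dist_origin Kk) => [->|[m' dv' ->]].
  by move=> _ e; exfalso; lia.
by move: dv'; rewrite dv => -[->].
Qed.

End TreeDistance.

(** * Busemann functions *)

Section Rays.
Variables (q : nat) (q_pr : prime q).
Local Notation G := (PGL2 (padic q_pr)).
Local Notation vertex := (vertex q_pr).
Local Notation o := (origin q_pr).
Local Notation adj := (@Defs.adjacent q q_pr).
Local Notation tdist := (@Defs.tdist q q_pr).
Local Notation boundary := (boundary q_pr).
Implicit Types (u v : vertex) (w : boundary) (r s : nat -> vertex).

Lemma geodesic_adjacent r i : geodesic r -> adj (r i) (r i.+1).
Proof.
move=> gr; have := tdist_walk (r i) (r i.+1); rewrite gr // subSnn.
by move=> [s [<- <-]]; exact.
Qed.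

Lemma tdist_steps r m n : (forall i, adj (r i) (r i.+1)) -> (m <= n)%N ->
  (tdist (r m) (r n) <= n - m)%N.
Proof.
move=> rA mn; apply: tdist_le; exists (fun i => r (m + i)%N).
by rewrite addn0 subnKC //; split=> // i _; rewrite addnS.
Qed.

(** A shortcut between two vertices would shorten the way from the start to every later vertex. *)
Lemma geodesic_steps r : (forall i, adj (r i) (r i.+1)) ->
  (forall n, exists2 m, (n <= m)%N & tdist (r 0%N) (r m) = m) -> geodesic r.
Proof.
move=> rA far m n mn; apply/eqP; rewrite eqn_leq tdist_steps //=.
have [M nM dM] := far n.
have h1 := tdist_steps rA (leq0n m); have h2 := tdist_steps rA nM.
have h3 := tdist_triangle (r 0%N) (r m) (r M).
by have h4 := tdist_triangle (r m) (r n) (r M); lia.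
Qed.

(* Seen from [v], a geodesic ray first approaches and then moves away for     *)
(* good: turning back towards [v] would use the unique closer neighbour twice.*)
Lemma ray_recedes r v i : geodesic r ->
  tdist v (r i.+1) = (tdist v (r i)).+1 ->
  tdist v (r i.+2) = (tdist v (r i.+1)).+1.
Proof.
move=> gr di; have [//|di'] := adjacent_dist v (geodesic_adjacent i.+1 gr).
have eq_ri := closer_unique (adjacent_sym (geodesic_adjacent i gr))
  (geodesic_adjacent i.+1 gr) di di'.
have := gr i i.+2 (leq_trans (leqnSn _) (leqnSn _)).
by rewrite -eq_ri tdistvv => e; exfalso; lia.
Qed.

Lemma ray_approach r v n : geodesic r ->
  (exists2 i, (i < n)%N & tdist v (r i.+1) = (tdist v (r i)).+1) \/
  (tdist v (r n) + n = tdist v (r 0))%N.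
Proof.
move=> gr; elim: n => [|n [[i iln di]|IH]]; first by right; rewrite addn0.
  by left; exists i => //; exact: ltnW.
have [dn|dn] := adjacent_dist v (geodesic_adjacent n gr); last by right; lia.
by left; exists n.
Qed.

(** The distance cannot decrease [N] times, so the ray recedes from [v] before step [N] and ever
    after. The threshold depends on the ray only through its first vertex. *)
Lemma ray_eventually r v i (N := (tdist v (r 0%N)).+1) : geodesic r ->
  tdist v (r (N + i)%N) = (tdist v (r N) + i)%N.
Proof.
move=> gr; have [[j jN dj]|] := ray_approach v N gr; last first.
  by rewrite /N => e; exfalso; lia.
have step k : tdist v (r (j + k).+1) = (tdist v (r (j + k)%N)).+1.
  elim: k => [|k IH]; first by rewrite addn0.
  by rewrite addnS; exact: ray_recedes.
elim: i => [|i IH]; first by rewrite !addn0.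
rewrite !addnS (_ : (N + i = j + (N + i - j))%N); last by lia.
by rewrite step -IH; congr (tdist v (r _)).+1; lia.
Qed.

(** A shortest walk from [v] to a vertex past which the given ray recedes is continued along that
    ray. Hence [ray_from] never takes its default value. *)
Lemma ray_exists v w : exists r : ray q_pr, r 0%N = v /\ \pi_boundary r = w.
Proof.
pose r := repr w; have gr := ray_geodesic r.
pose N := (tdist v (r 0%N)).+1; pose l := tdist v (r N).
have [s [s0 sl sA]] := tdist_walk v (r N); rewrite -/l in sl sA.
pose t i := if (i <= l)%N then s i else r (N + (i - l))%N.
have tl i : t (l + i)%N = r (N + i)%N.
  rewrite /t; case: i => [|i]; first by rewrite !addn0 leqnn sl.
  by rewrite leqNgt addnS ltnS leq_addr /=; congr (r _); lia.
have t0 : t 0%N = v by rewrite /t.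
have gt : geodesic t.
  apply: geodesic_steps => [i|n].
    have [il|li] := ltnP i l.
      by rewrite /t (ltnW il) il; exact: sA.
    by rewrite -(subnKC li) -addnS !tl addnS; exact: geodesic_adjacent.
  by exists (l + n)%N; [exact: leq_addl | rewrite t0 tl ray_eventually].
exists (Ray gt); split=> //; rewrite -[RHS]reprK; apply/eqmodP/asboolP.
by exists l, N => i; rewrite /= tl.
Qed.

Lemma ray_fromP v w : ray_from v w 0%N = v /\ \pi_boundary (ray_from v w) = w.
Proof.
have [r hr] := ray_exists v w.
by apply: (@xgetPex _ (repr w)
  [set r : ray q_pr | r 0%N = v /\ \pi_boundary r = w]); exists r.
Qed.

(** The unspecified common vertex is traded for the vertex at depth [N] of [o, w), with [N]
    depending on g alone. So b(g) is determined by one vertex of the ray and by g.o. *)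
Lemma busemannE (R : realType) (g : G) w (N := (tdist (vact g o) o).+1) :
  busemann R g w = N%:R - (tdist (vact g o) (ray_from o w N))%:R.
Proof.
set v := vact g o; set r := ray_from o w; pose s := ray_from v w.
have [r0 rw] := ray_fromP o w; have [s0 sw] := ray_fromP v w.
rewrite -/r -/s in r0 rw s0 sw.
have [gr gs] := (ray_geodesic r, ray_geodesic s).
have /eqmodP/asboolP[a [b ab]] : \pi_boundary r = \pi_boundary s.
  by rewrite rw sw.
rewrite /busemann -/v -/r -/s; set x := xget _ _.
have [[k _ kx] [l _ lx]] : (range r `&` range s) x.
  apply: (@xgetPex _ o (range r `&` range s)); exists (r a).
  by split; [exists a | exists b => //; rewrite -[b]addn0 -ab addn0].
have dr : tdist o x = k by rewrite -kx -r0 gr // subn0.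
have ds : tdist v x = l by rewrite -lx -s0 gs // subn0.
(* The offset k + l puts the common point beyond x on both rays; comparing its distance to x along
   each gives k - l = a - b. *)
have far := ab (k + l)%N.
have e1 : (a + l = b + k)%N.
  have := gr k (a + (k + l))%N; have := gs l (b + (k + l))%N.
  rewrite far kx lx => -> //; last by lia.
  by move=> e; have := e ltac:(lia); lia.
(* The distance from g.o to r(N + a) = s(b + N) is computed once along each ray. *)
have e2 : (b + N = tdist v (r N) + a)%N.
  have := ray_eventually v a gr; rewrite r0 -/N => <-.
  by rewrite (addnC N) ab -s0 gs // subn0.
rewrite dr ds; apply/eqP; rewrite subr_eq addrAC eq_sym subr_eq -!natrD eqr_nat.
by apply/eqP; lia.
Qed.

Lemma nbhs_boundary n w : \forall w' \near w,
  forall i, (i <= n)%N -> ray_from o w' i = ray_from o w i.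
Proof.
apply: (@open_nbhs_nbhs _ w [set w' |
  forall i, (i <= n)%N -> ray_from o w' i = ray_from o w i]); split=> //.
move=> w' w'w; exists n => w'' w''w' i ni; by rewrite w''w' // w'w.
Qed.

Lemma bfun_locally_constant (R : realType) (g : G) :
  locally_constant (bfun R g).
Proof.
move=> w; pose N := (tdist (vact g o) o).+1.
by apply: filterS (nbhs_boundary N w) => w' w'w; rewrite /bfun !busemannE w'w.
Qed.

Lemma bfun_origin (R : realType) (g h : G) : vact g o = vact h o ->
  bfun R g = bfun R h.
Proof.
by move=> gh; apply/funext => w; rewrite /bfun !busemannE gh.
Qed.

End Rays.

(** * The metric Delta *)

Section Spheres.
Variables (q : nat) (q_pr : prime q).
Local Notation G := (PGL2 (padic q_pr)).
Local Notation vertex := (vertex q_pr).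
Local Notation o := (origin q_pr).
Local Notation std := (std_ray q_pr).
Local Notation tdist := (@Defs.tdist q q_pr).
Implicit Types (u v : vertex) (s : seq vertex).

Lemma sphere_parent n v : sphere n.+1 v ->
  exists2 u, sphere n u & Defs.adjacent u v.
Proof.
move=> vn; have [k Kk ->] := vertex_polar v; rewrite vn.
exists (vact k (std n)); first exact: tdist_origin_std.
exact/adjacent_vact/std_adjacent.
Qed.

(** Each vertex of the next sphere is a forward neighbour of its parent: q for each parent, and one
    more at the origin. *)
Lemma sphere_succ n s : (forall v, sphere n v -> v \in s) ->
  exists s', size s' = (size s * q + (n == 0%N) * size s)%N /\
    forall v, sphere n.+1 v -> v \in s'.
Proof.
move=> hs; have [k kP] := choice (fun v : vertex =>
  let: ex_intro2 k Kk vk := vertex_polar v in ex_intro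
    (fun k : G => origin_stab k /\ v = vact k (std (tdist o v)))
    k (conj Kk vk)).
exists ([seq vact (k u * lower q_pr n c)%g (std n.+1) |
           u <- s, c <- iota 0 q] ++
        if n == 0%N then [seq vact (k u * swap q_pr)%g (std 1) | u <- s]
        else [::]).
split.
  rewrite size_cat size_allpairs size_iota; congr addn.
  by case: n {hs} => [|n] /=; rewrite ?mul1n ?size_map.
move=> v vn; have [u un uv] := sphere_parent vn; have [Ku uE] := kP u.
have us := hs _ un; rewrite un in uE.
rewrite uE in uv; case/adjacent_std: uv => [[c cq ->]|vE]; rewrite mem_cat.
  apply/orP; left; apply/allpairsP; exists (u, c); split=> //=.
  by rewrite mem_iota.
apply/orP; right; case: n {hs un} vE vn uE => [|n] -> vn uE /=.
  by apply/mapP; exists u.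
by exfalso; move: vn; rewrite /sphere /= tdist_origin_std //; lia.
Qed.

Lemma sphere_bound n : exists s, size s = (q.+1 * q ^ n)%N /\
  forall v, sphere n.+1 v -> v \in s.
Proof.
elim: n => [|n [s [ss hs]]].
  have [v /tdist_eq0 <-|s [ss hs]] := @sphere_succ 0 [:: o].
    exact: mem_head.
  by exists s; split=> //; rewrite ss /=; lia.
have [s' [ss' hs']] := sphere_succ hs.
by exists s'; split=> //; rewrite ss' ss expnSr /=; lia.
Qed.

Lemma ball_finite n : exists s, forall v, (tdist o v <= n)%N -> v \in s.
Proof.
elim: n => [|n [s hs]].
  exists [:: o] => v; rewrite leqn0 => /eqP /tdist_eq0 <-; exact: mem_head.
have [s' [_ hs']] := sphere_bound n.
exists (s ++ s') => v; rewrite leq_eqVlt ltnS mem_cat => /orP[/eqP|].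
  by move/hs' ->; rewrite orbT.
by move/hs ->.
Qed.

End Spheres.

Lemma esum_le_size (R : realType) (T : choiceType) (S : set T) (s : seq T)
    (a : T -> \bar R) (B : R) : 0 <= B -> (forall v, S v -> v \in s) ->
  (forall v, S v -> (a v <= B%:E)%E) ->
  (\esum_(v in S) a v <= ((size s)%:R * B)%:E)%E.
Proof.
move=> B0 Ss aB; apply: ge_ereal_sup => _ [A [finA AS] <-].
rewrite fsbig_finite //=.
apply: (@le_trans _ _ (\sum_(v <- fset_set A) B%:E)%E).
  rewrite big_seq [leRHS]big_seq; apply: lee_sum => v.
  by rewrite in_fset_set // inE => /AS /aB.
rewrite sumEFin lee_fin big_const_seq count_predT iter_addr_0 -[leLHS]mulr_natl.
apply: ler_wpM2r => //; rewrite ler_nat; apply: uniq_leq_size => // v.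
by rewrite in_fset_set // inE => /AS /Ss.
Qed.

Section DeltaBounds.
Variables (R : realType) (q : nat) (q_pr : prime q).
Local Notation G := (PGL2 (padic q_pr)).
Local Notation o := (origin q_pr).
Local Notation tdist := (@Defs.tdist q q_pr).
Implicit Types (g h : G).

Definition displacement g h v : R := (tdist (vact g v) (vact h v))%:R.

Definition sphere_term g h n : \bar R :=
  \esum_(v in sphere n) (displacement g h v /
    (q.+1%:R ^+ n * (1 + displacement g h v)))%:E.

Lemma DeltaE g h : Delta R g h =
  ((displacement g h o)%:E + \sum_(1 <= n <oo) sphere_term g h n)%E.
Proof. by []. Qed.

Lemma displacement_ge0 g h v : 0 <= displacement g h v.
Proof. exact: ler0n. Qed.

Lemma term_ge0 g h n v : 0 <= displacement g h v /
    (q.+1%:R ^+ n * (1 + displacement g h v)).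
Proof.
have d0 := displacement_ge0 g h v.
by rewrite divr_ge0 // mulr_ge0 ?exprn_ge0 ?addr_ge0.
Qed.

Lemma sphere_term_ge0 g h n : (0 <= sphere_term g h n)%E.
Proof. by apply: esum_ge0 => v _; rewrite lee_fin term_ge0. Qed.

(** If g and h differ at v, the displacement d is at least 1, so d/(1 + d) >= 1/2 and the term of v
    alone reaches the bound. *)
Lemma Delta_small_eq g h v :
  (Delta R g h < ((q.+1%:R ^+ tdist o v * 2)^-1)%:E)%E -> vact g v = vact h v.
Proof.
move=> small; apply: contrapT => ne; move: small.
apply/negP; rewrite -leNgt DeltaE.
have d1 : 1 <= displacement g h v.
  rewrite /displacement ler1n lt0n; apply/eqP => /tdist_eq0; exact: ne.
have d0 := displacement_ge0 g h.
have Q0 n : 0 < q.+1%:R ^+ n :> R by rewrite exprn_gt0 // ltr0n.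
have s0 n : (1 <= n)%N -> xpredT n -> (0 <= sphere_term g h n)%E.
  by move=> _ _; exact: sphere_term_ge0.
have [n0|n0] := posnP (tdist o v).
  rewrite n0 expr0 mul1r (tdist_eq0 n0).
  apply: (@le_trans _ _ (displacement g h v)%:E).
    by rewrite lee_fin; lra.
  by rewrite leeDl // nneseries_ge0.
apply: (@le_trans _ _ (sphere_term g h (tdist o v))); last first.
  apply: (@le_trans _ _ (\sum_(1 <= n < (tdist o v).+1) sphere_term g h n)%E).
    rewrite big_nat_recr //= leeDr // sume_ge0 // => n _.
    exact: sphere_term_ge0.
  apply: le_trans (nneseries_lim_ge _ s0) _.
  by rewrite leeDr // lee_fin.
apply: esum_ge; exists [set v].
  by split=> // _ ->.
rewrite fsbig_set1 lee_fin invfM [leRHS]mulrC invfM -mulrA.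
rewrite ler_pM2l ?invr_gt0 // mulrC ler_pdivlMr; last by have := d0 v; lra.
by have := d0 v; lra.
Qed.

(** With rho = q/(q + 1), the sphere of radius m + 1 contributes at most rho^m, and spheres of
    radius at most n contribute nothing; the tail sums to rho^n/(1 - rho) = (q + 1) rho^n. *)
Lemma Delta_ball_le g h n :
    (forall v, (tdist o v <= n)%N -> vact g v = vact h v) ->
  (Delta R g h <= (q.+1%:R * (q%:R / q.+1%:R) ^+ n)%:E)%E.
Proof.
move=> gh; set rho : R := q%:R / q.+1%:R.
have Q0 : 0 < q.+1%:R :> R by rewrite ltr0n.
have rho0 : 0 <= rho by rewrite divr_ge0.
have disp0 v : (tdist o v <= n)%N -> displacement g h v = 0.
  by move=> /gh e; rewrite /displacement e tdistvv.
rewrite DeltaE disp0 ?tdistvv // add0e.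
have small m : (m <= n)%N -> sphere_term g h m = 0%E.
  by move=> mn; apply: esum1 => v vm; rewrite disp0 ?mul0r // vm.
have bound m : (sphere_term g h m.+1 <= (rho ^+ m)%:E)%E.
  have [s [ss hs]] := sphere_bound q_pr m.
  have B0 : 0 <= (q.+1%:R ^+ m.+1)^-1 :> R by rewrite invr_ge0 exprn_ge0.
  apply: le_trans (esum_le_size B0 hs _) _.
  - move=> v _; rewrite lee_fin invfM mulrCA ler_piMr ?invr_ge0 ?exprn_ge0 //.
    have d0 := displacement_ge0 g h v.
    by rewrite ler_pdivrMr; lra.
  - rewrite lee_fin ss natrM natrX exprS invfM expr_div_n.
    by rewrite mulrACA divff ?mul1r // gt_eqF.
(* The maximum makes the bound vanish while k <= n. *)
have partial k : (\sum_(1 <= m < k.+1) sphere_term g h m <=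
    (q.+1%:R * (rho ^+ n - rho ^+ maxn n k))%:E)%E.
  elim: k => [|k IH]; first by rewrite big_geq // maxn0 subrr mulr0.
  rewrite big_nat_recr //=; apply: le_trans (leeD IH (lexx _)) _.
  have [kn|nk] := ltnP k n.
    by rewrite small // adde0 (maxn_idPl kn).
  apply: le_trans (leeD (lexx _) (bound k)) _.
  rewrite -EFinD lee_fin (maxn_idPr (leqW nk)) exprS.
  have -> : q.+1%:R * (rho ^+ n - rho * rho ^+ k) =
      q.+1%:R * rho ^+ n - q%:R * rho ^+ k.
    rewrite mulrBr mulrA /rho; congr (_ - _ * _).
    by rewrite mulrC divfK // gt_eqF.
  by rewrite -natr1; lra.
apply: lime_le.
  by apply: is_cvg_nneseries => m _ _; exact: sphere_term_ge0.
apply: nearW => -[|k]; first by rewrite big_geq // lee_fin mulr_ge0 ?exprn_ge0.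
apply: le_trans (partial k) _; rewrite lee_fin ler_pM2l //.
by rewrite lerBlDr lerDl exprn_ge0.
Qed.

Lemma Delta_ball_small (e : R) : 0 < e -> exists n, forall g h,
  (forall v, (tdist o v <= n)%N -> vact g v = vact h v) ->
  (Delta R g h < e%:E)%E.
Proof.
move=> e0; have Q0 : 0 < q.+1%:R :> R by rewrite ltr0n.
set rho : R := q%:R / q.+1%:R; have rho1 : `|rho| < 1.
  by rewrite ger0_norm ?divr_ge0 // ltr_pdivrMr // mul1r ltr_nat.
have /cvgrPdist_lt/(_ _ (divr_gt0 e0 Q0)) := cvg_expr rho1.
move=> [n _ /(_ n (leqnn n)) /=]; rewrite sub0r normrN => small.
exists n => g h /Delta_ball_le; move/le_lt_trans; apply.
rewrite lte_fin mulrC -ltr_pdivlMr //; exact: le_lt_trans (ler_norm _) small.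
Qed.

End DeltaBounds.

(** * Step functions and approximation of currents *)

Section StepFunctions.
Variables (d : measure_display) (X : measurableType d).

(** This form, without a chosen partition, makes pairs and preimages immediate. *)
Lemma step_funP (T : Type) (f : X -> T) : step_fun f <->
  finite_set (range f) /\ forall y, measurable (f @^-1` [set y]).
Proof.
split=> [[n [A [mA _ A_cover f_cst]]]|[fin_f mf]].
  have A_at x : exists i, A i x.
    by have : [set: X] x by []; rewrite -A_cover => -[i _ Aix]; exists i.
  split.
    apply: (@sub_finite_set _ _ (\bigcup_(i in [set: 'I_n]) (f @` A i))).
      by move=> _ [x _ <-]; have [i Aix] := A_at x; exists i => //; exists x.
    apply: bigcup_finite => // i _.
    have [[x Aix]|nA] := pselect (A i !=set0).
      apply: (@sub_finite_set _ _ [set f x]) => // _ [y Aiy <-].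
      exact: f_cst Aiy Aix.
    by apply: (@sub_finite_set _ _ set0) => // z [y Aiy _]; apply: nA; exists y.
  move=> y; rewrite (_ : _ @^-1` _ =
      \bigcup_(i in [set i | exists2 x, A i x & f x = y]) A i).
    apply: fin_bigcup_measurable => //.
  apply/seteqP; split=> [x fx|x [i [x' Aix' <-] Aix]].
    by have [i Aix] := A_at x; exists i => //; exists x.
  exact: f_cst Aix Aix'.
have [n /card_set_bijP[e [e_lt e_inj _]]] := fin_f.
have fr x : range f (f x) by exists x.
exists n, (fun i => [set x | e (f x) = i :> nat]); split.
- move=> i; have [[x exi]|none] := pselect (exists x, e (f x) = i).
    rewrite (_ : mkset _ = f @^-1` [set f x]) //.
    apply/seteqP; split=> [x' ex'|x' /= -> //].
    by apply: e_inj; rewrite ?inE // exi.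
  by rewrite (_ : mkset _ = set0) // -subset0 => x exi; apply: none; exists x.
- by move=> i j _ _ [x [/= ei ej]]; apply: val_inj; exact: etrans (esym ei) ej.
- apply/seteqP; split=> // x _.
  by exists (Ordinal (e_lt _ (fr x))).
- move=> i x y ex ey; apply: e_inj; rewrite ?inE //.
  exact: etrans ex (esym ey).
Qed.

Lemma step_fun_comp (T U : Type) (h : T -> U) (f : X -> T) :
  step_fun f -> step_fun (h \o f).
Proof.
move=> [n [A [mA tA cA f_cst]]]; exists n, A; split=> // i x y Aix Aiy.
by congr h; exact: f_cst Aix Aiy.
Qed.

Lemma step_fun_cst (T : Type) (c : T) : step_fun (fun _ : X => c).
Proof.
apply/step_funP; split.
  by apply: (@sub_finite_set _ _ [set c]) => // _ [x _ <-].
move=> y; have [->|cy] := pselect (c = y).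
  by rewrite (_ : _ @^-1` _ = setT) //; apply/seteqP.
by rewrite (_ : _ @^-1` _ = set0) //; apply/seteqP; split.
Qed.

Lemma step_fun_pair (T U : Type) (f : X -> T) (g : X -> U) :
  step_fun f -> step_fun g -> step_fun (fun x => (f x, g x)).
Proof.
move=> /step_funP[ff mf] /step_funP[fg mg]; apply/step_funP; split.
  apply: sub_finite_set (finite_setX ff fg) => _ [x _ <-].
  by split; exists x.
move=> [y z]; rewrite (_ : _ @^-1` _ = f @^-1` [set y] `&` g @^-1` [set z]).
  exact: measurableI.
by apply/seteqP; split=> x /= [-> ->].
Qed.

Lemma step_fun_map (I T : Type) (F : I -> X -> T) (s : seq I) :
  (forall i, step_fun (F i)) -> step_fun (fun x => [seq F i x | i <- s]).
Proof.
move=> stepF; elim: s => [|i s IH]; first exact: step_fun_cst.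
exact: (step_fun_comp (fun p => p.1 :: p.2) (step_fun_pair (stepF i) IH)).
Qed.

Lemma step_fun_preimage (T : Type) (f : X -> T) (B : set T) :
  step_fun f -> measurable (f @^-1` B).
Proof.
move=> /step_funP[fin_f mf].
rewrite (_ : _ @^-1` _ = \bigcup_(y in range f `&` B) f @^-1` [set y]).
  by apply: fin_bigcup_measurable => //; exact: finite_setIl.
apply/seteqP; split=> [x Bfx|x [y [_ By] /= ->] //].
by exists (f x) => //; split=> //; exists x.
Qed.

Lemma step_fun_integrable (R : realType) (mu : {measure set X -> \bar R})
    (f : X -> R) :
  (mu setT < +oo)%E -> step_fun f -> mu.-integrable setT (EFin \o f).
Proof.
move=> mu_fin sf; apply: measurable_bounded_integrable => //.
  by move=> _ B mB; rewrite setTI; exact: step_fun_preimage.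
have [fin_f _] := (step_funP f).1 sf.
have [s sE] := (finite_seqP _).1 fin_f.
exists (\sum_(y <- s) `|y|); split; first exact: num_real.
move=> M sM x _ /=; apply: le_trans (ltW sM).
have : f x \in s by have : range f (f x) by [exists x]; rewrite sE.
elim: s {sE sM} => // y s IH; rewrite inE big_cons => /orP[/eqP ->|/IH].
  by rewrite lerDl sumr_ge0.
by move/le_trans; apply; rewrite lerDr.
Qed.

End StepFunctions.

Section Currents.
Variables (R : realType) (q : nat) (q_pr : prime q) (X : ptopologicalType).
Local Notation G := (PGL2 (padic q_pr)).
Local Notation o := (origin q_pr).
Local Notation tdist := (@Defs.tdist q q_pr).
Implicit Types (xi eta : X -> G).

Lemma Delta_open_vact v u : Delta_open R [set g : G | vact g v = u].
Proof.
move=> g /= gv; exists (q.+1%:R ^+ tdist o v * 2)^-1.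
  by rewrite invr_gt0 mulr_gt0 // exprn_gt0 // ltr0n.
by move=> h /Delta_small_eq <-.
Qed.

Lemma bounded_currents_radius xi : bounded_currents R xi ->
  exists B, forall x, (tdist o (vact (xi x) o) <= B)%N.
Proof.
move=> [_ [N [s hs]]]; exists (\max_(g <- s) tdist o (vact g o))%N => x.
have [g gs /(_ o)] := hs x; rewrite tdistvv leq0n => /(_ isT).
rewrite vactM => /(congr1 (vact g)); rewrite vactKV => ->.
exact: leq_bigmax_seq.
Qed.

(** Boundedness confines xi(x).v to a finite ball, and the fibres are measurable because g |-> g.v
    has [Delta]-open fibres. *)
Lemma step_fun_vact xi v : bounded_currents R xi ->
  @step_fun _ (borel X) _ (fun x => vact (xi x) v).
Proof.
move=> bxi; have [B hB] := bounded_currents_radius bxi.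
have [mxi _] := bxi.
have [s hs] := ball_finite q_pr (B + tdist o v).
apply/step_funP; split.
  apply: (@sub_finite_set _ _ [set` s]); last exact: finite_seq.
  move=> _ [x _ <-]; apply: hs.
  apply: leq_trans (tdist_triangle _ (vact (xi x) o) _) _.
  by rewrite tdist_vact leq_add2r hB.
move=> u; rewrite -[X in measurable X]setTI.
exact: (mxi measurableT [set g | vact g v = u]
  (@sub_sigma_algebra _ setT _ _ (@Delta_open_vact v u))).
Qed.

(** The images of the finitely many vertices of the ball form a tuple that is a step function of x;
    choosing one value of [xi] for each tuple gives [eta]. *)
Lemma step_approx xi n : bounded_currents R xi ->
  exists2 eta, step_currents eta &
    forall x v, (tdist o v <= n)%N -> vact (eta x) v = vact (xi x) v.
Proof.
move=> bxi; have [s hs] := ball_finite q_pr n.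
pose A x := [seq vact (xi x) v | v <- s].
have stepA : @step_fun _ (borel X) _ A.
  exact: (@step_fun_map _ (borel X) _ _ (fun v x => vact (xi x) v) s
    (fun v => step_fun_vact v bxi)).
have [e eP] : exists e : seq (vertex q_pr) -> G,
    forall x, exists2 x', A x' = A x & e (A x) = xi x'.
  have ex a : exists g, forall x, A x = a -> exists2 x', A x' = a & g = xi x'.
    have [[x Ax]|none] := pselect (exists x, A x = a).
      by exists (xi x) => _ _; exists x.
    by exists 1%g => x Ax; case: none; exists x.
  by have [e eP] := choice ex; exists e => x; exact: eP.
exists (e \o A); first exact: step_fun_comp.
move=> x v vn; have [x' Ax' /= ->] := eP x.
by have /eq_in_map/(_ v (hs _ vn)) := Ax'.
Qed.

Lemma step_currents_bounded xi : step_currents xi -> bounded_currents R xi.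
Proof.
move=> sxi; split.
  by move=> _ B mB; rewrite setTI; exact: step_fun_preimage.
have [/finite_seqP[s sE] _] := (@step_funP _ (borel X) _ xi).1 sxi.
exists 0%N, s => x; exists (xi x).
  by have : range xi (xi x) by [exists x]; rewrite sE.
by move=> v _; rewrite mulVg vact1.
Qed.

Lemma step_currents_div xi eta : step_currents xi -> step_currents eta ->
  step_currents (fun x => (eta x)^-1 * xi x)%g.
Proof.
move=> sxi seta.
exact: (@step_fun_comp _ (borel X) _ _ (fun p => p.1^-1 * p.2)%g _
  (step_fun_pair seta sxi)).
Qed.

Lemma delta_ball_small (e : R) : 0 < e -> exists n, forall xi eta,
  (forall x v, (tdist o v <= n)%N -> vact (xi x) v = vact (eta x) v) ->
  (delta R xi eta < e%:E)%E.
Proof.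
move=> e0; have [n hn] := Delta_ball_small q_pr (divr_gt0 e0 (ltr0n R 2)).
(* The supremum of quantities below e/2 is only known to be at most e/2, hence the halving. *)
exists n => xi eta h; apply: (@le_lt_trans _ _ (e / 2)%:E).
  by apply: ge_ereal_sup => _ [x _ <-]; exact/ltW/hn/h.
by rewrite lte_fin; lra.
Qed.

Lemma delta_lt1_origin xi eta : (delta R xi eta < (2^-1)%:E)%E ->
  forall x, vact (xi x) o = vact (eta x) o.
Proof.
move=> small x; apply: (@Delta_small_eq R); rewrite tdistvv expr0 mul1r.
by apply: le_lt_trans small; apply: ereal_sup_ubound; exists x.
Qed.

(* A perturbation of [xi i] by an element fixing a large ball does not change *)
(* the image of the origin under [(xi j)^-1 * xi i].                          *)
Lemma step_approx_family n (xi : 'I_n -> X -> G) :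
  (forall i, bounded_currents R (xi i)) ->
  exists2 eta : 'I_n -> X -> G, (forall i, step_currents (eta i)) &
    forall i j x, vact ((eta j x)^-1 * eta i x)%g o =
                  vact ((xi j x)^-1 * xi i x)%g o.
Proof.
move=> bxi; have [B hB] := choice (fun i => bounded_currents_radius (bxi i)).
(* The radius bounds the distance from o to u = xi_j^-1 xi_i.o, so that eta_j agrees with xi_j at
   u. *)
pose M := (\max_i B i + \max_i B i)%N.
have [eta etaP] := choice (fun i =>
  let: ex_intro2 e se he := step_approx M (bxi i) in
  ex_intro (fun e => step_currents e /\ forall x v, (tdist o v <= M)%N ->
    vact (e x) v = vact (xi i x) v) e (conj se he)).
exists eta => [i|i j x]; first by case: (etaP i).
have [_ ei] := etaP i; have [_ ej] := etaP j.
pose u := vact (xi j x)^-1%g (vact (xi i x) o).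
rewrite vactM ei ?tdistvv // vactM -/u.
rewrite -[vact (xi i x) o](vactKV (xi j x)) -/u -ej ?vactK //.
rewrite /u -tdist_transfer; apply: leq_trans (tdist_triangle _ o _) _.
by rewrite tdist_sym leq_add // (leq_trans (hB _ _)) // leq_bigmax.
Qed.

End Currents.

(** * The vacuum coefficient *)

Section ComplexFacts.
Variable R : realType.

Lemma cexpC (x : R) : cexp x%:C = (expR x)%:C.
Proof. by rewrite /cexp /= cos0 sin0 mulr1 mulr0. Qed.

Lemma ip_self (V : lmodType R[i]) (ip : {dot V for Num.conj}) v :
  ip v v = (sqnorm ip v)%:C.
Proof.
have := dnorm_ge0 ip v; rewrite lecE => /andP[/eqP /= im0 _].
by rewrite /sqnorm; case: (ip v v) im0 => a b /= ->.
Qed.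

Lemma sqnorm_ge0 (V : lmodType R[i]) (ip : {dot V for Num.conj}) v :
  0 <= sqnorm ip v.
Proof.
by have := dnorm_ge0 ip v; rewrite ip_self -(rmorph0 (real_complex R)) lecR.
Qed.

Lemma ip_sum_ge0 (V : lmodType R[i]) (ip : {dot V for Num.conj}) n
    (c : 'I_n -> R[i]) (u : 'I_n -> V) :
  0 <= \sum_(i < n) \sum_(j < n) c i * (c j)^* * ip (u i) (u j).
Proof.
have := dnorm_ge0 ip (\sum_i c i *: u i).
rewrite linear_sumlz; congr (0 <= _); apply: eq_bigr => i _.
rewrite linear_sumr; apply: eq_bigr => j _.
by rewrite linearZl_LR linearZr_LR /= mulrA.
Qed.

End ComplexFacts.

Section Vacuum.
Variables (R : realType) (q : nat) (q_pr : prime q) (X : ptopologicalType).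
Variables (mu : {measure set (borel X) -> \bar R}) (mu_fin : (mu setT < +oo)%E).
Variables (nu : probability (borel (boundary q_pr)) R).
Variables (Hq : lmodType R[i]) (ipq : {dot Hq for Num.conj}).
Variables (iota : (boundary q_pr -> R[i]) -> Hq).
Hypothesis Hq_def : is_steinberg_space nu ipq iota.
Variables (St : PGL2 (padic q_pr) -> {linear Hq -> Hq}).
Variables (HX : lmodType R[i]) (ipX : {dot HX for Num.conj}).
Variables (cls : (borel X -> Hq) -> HX).
Hypothesis HX_def : is_L2 mu ipq ipX cls.
Variables (E : lmodType R[i]) (ipE : {dot E for Num.conj}) (EXP : HX -> E).
Hypothesis E_def : is_fock ipX ipE EXP.
Variables (Xi : (X -> PGL2 (padic q_pr)) -> {linear E -> E}).
Hypothesis Xi_def : is_fock_rep mu ipq iota St ipX cls ipE EXP Xi.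
Implicit Types (xi eta : X -> PGL2 (padic q_pr)).

(** The extension itself: the formula is already meaningful for bounded currents. *)
Definition vacuum_form xi : R[i] := (q%:R `^ (- 2^-1 *
  \int[mu]_x steinberg_sqnorm nu (bfun R (xi x))))%:C.

Lemma step_fun_square_integrable (u : borel X -> Hq) :
  step_fun u -> square_integrable mu ipq u.
Proof.
move=> su; split.
  exists (fun=> u) => // x e e0; exists 0%N => n _.
  by rewrite subrr /sqnorm linear0l.
have sn : step_fun (sqnorm ipq \o u) by exact: step_fun_comp.
have /integrableP[_] := step_fun_integrable mu_fin sn.
apply: le_lt_trans; rewrite le_eqVlt; apply/orP; left; apply/eqP.
by apply: eq_integral => x _; rewrite /= ger0_norm // sqnorm_ge0.
Qed.

Lemma cls0 : cls (fun=> 0) = 0.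
Proof.
have s0 : square_integrable mu ipq (fun=> 0).
  exact/step_fun_square_integrable/step_fun_cst.
have := L2_linear HX_def 1 s0 s0.
rewrite (_ : (fun x => 1 *: 0 + 0) = (fun=> 0)); last first.
  by apply/funext => x; rewrite scaler0 addr0.
by rewrite scale1r => e; apply: (addrI (cls (fun=> 0))); rewrite -e addr0.
Qed.

Lemma cls_norm (u : borel X -> Hq) : step_fun u ->
  ipX (cls u) (cls u) = (\int[mu]_x sqnorm ipq (u x))%:C.
Proof.
move=> su; have siu := step_fun_square_integrable su.
rewrite (L2_ip HX_def siu siu) /cintegral; congr (_ +i* _).
transitivity (\int[mu]_x (0 : R)); last by rewrite Rintegral_cst // mul0r.
by apply: eq_Rintegral => x _; rewrite ip_self.
Qed.

(** For v = 0 the cocycle formula loses its cross term, and the pairing of [EXP b] with [EXP 0] is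
    exp 0 = 1. Local constancy of b(g) is what allows [steinberg_norm] to be applied. *)
Lemma vacuum_coefficient xi : step_currents xi ->
  ipE (Xi xi (EXP 0)) (EXP 0) = vacuum_form xi.
Proof.
move=> sxi; pose u x := iota (bfun R (xi x)).
have su : @step_fun _ (borel X) _ u.
  exact: (@step_fun_comp _ (borel X) _ _ (fun g => iota (bfun R g)) xi sxi).
have s0 : square_integrable mu ipq (fun=> 0).
  exact/step_fun_square_integrable/step_fun_cst.
rewrite -[X in Xi _ (EXP X)]cls0 (fock_rep_exp Xi_def sxi s0) /=.
rewrite (_ : (fun x => St (xi x) 0) = (fun=> 0)); last first.
  by apply/funext => x; rewrite linear0.
rewrite cls0 add0r linear0l subr0 linearZl_LR /= (fock_ip E_def) linear0r.
rewrite (cls_norm su) -(rmorph0 (real_complex R)) cexpC expR0 mulr1.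
have -> : - 2^-1 * (\int[mu]_x sqnorm ipq (u x))%:C =
    (- 2^-1 * \int[mu]_x sqnorm ipq (u x))%:C :> R[i].
  by rewrite rmorphM rmorphN /= rmorphV ?unitfE ?pnatr_eq0 // rmorph_nat.
rewrite cexpC /vacuum_form; congr (_%:C).
have q0 : (q%:R : R) != 0 by rewrite pnatr_eq0 -lt0n prime_gt0.
rewrite /powR (negbTE q0); congr expR.
rewrite -mulrA; congr (_ * _); rewrite mulrC -RintegralZl //; last first.
  exact: step_fun_integrable mu_fin (@step_fun_comp _ (borel X) _ _
    (fun g => steinberg_sqnorm nu (bfun R g)) xi sxi).
apply: eq_Rintegral => x _; apply: (steinberg_norm Hq_def).
exact: bfun_locally_constant.
Qed.

Lemma vacuum_form_origin xi eta :
  (forall x, vact (xi x) (origin q_pr) = vact (eta x) (origin q_pr)) ->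
  vacuum_form xi = vacuum_form eta.
Proof.
move=> e; pose F (b : borel X -> boundary q_pr -> R[i]) : R[i] :=
  (q%:R `^ (- 2^-1 * \int[mu]_x steinberg_sqnorm nu (b x)))%:C.
have eb : (fun x => bfun R (xi x)) = (fun x => bfun R (eta x)).
  by apply/funext => x; exact: bfun_origin.
exact: (congr1 F eb).
Qed.

(** Unitarity and multiplicativity turn each coefficient into the inner product of
    [Xi (xi i) (EXP 0)] and [Xi (xi j) (EXP 0)]. *)
Lemma vacuum_positive_definite :
  positive_definite step_currents (fun xi => ipE (Xi xi (EXP 0)) (EXP 0)).
Proof.
move=> n xi c sxi; have := ip_sum_ge0 ipE c (fun i => Xi (xi i) (EXP 0)).
congr (0 <= _); apply: eq_bigr => i _; apply: eq_bigr => j _; congr (_ * _).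
have sij := step_currents_div (sxi i) (sxi j).
rewrite -[RHS](fock_rep_unitary Xi_def (sxi j)).
rewrite -(fock_repM Xi_def (sxi j) sij); congr (ipE (Xi _ _) _).
by apply/funext => x; rewrite mulgA mulgV mul1g.
Qed.

Lemma vacuum_form_positive_definite :
  positive_definite (bounded_currents R) vacuum_form.
Proof.
move=> n xi c bxi; have [eta seta etaP] := step_approx_family bxi.
have := vacuum_positive_definite c seta; congr (0 <= _).
apply: eq_bigr => i _; apply: eq_bigr => j _; congr (_ * _).
rewrite vacuum_coefficient; last exact: step_currents_div.
by apply: vacuum_form_origin => x; exact: etaP.
Qed.

Lemma vacuum_form_continuous :
  delta_continuous (bounded_currents R) vacuum_form.
Proof.
move=> xi _ e e0; exists 2^-1; first by rewrite invr_gt0.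
move=> eta _ /delta_lt1_origin /vacuum_form_origin ->.
by rewrite subrr Normc.normc0.
Qed.

End Vacuum.

(** * Uniqueness of the extension, and the theorem *)

Lemma normc_ge0 (R : realType) (z : R[i]) : 0 <= Normc.normc z.
Proof. by case: z => a b /=; exact: sqrtr_ge0. Qed.

(** Step currents are dense: one that agrees with xi on a large ball is close enough for both
    functions at once. *)
Lemma delta_continuous_eq (R : realType) (q : nat) (q_pr : prime q)
    (X : ptopologicalType) (phi psi : (X -> PGL2 (padic q_pr)) -> R[i]) :
  delta_continuous (bounded_currents R) phi ->
  delta_continuous (bounded_currents R) psi ->
  (forall xi, step_currents xi -> phi xi = psi xi) ->
  forall xi, bounded_currents R xi -> phi xi = psi xi.
Proof.
move=> cphi cpsi e xi bxi; apply/eqP; rewrite -subr_eq0; apply/eqP.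
apply: Normc.eq0_normc; apply/eqP; rewrite eq_le normc_ge0 andbT.
apply/ler_addgt0Pr => a a0; rewrite add0r.
have [r r0 hr] := cphi xi bxi _ (divr_gt0 a0 (ltr0n R 2)).
have [s s0 hs] := cpsi xi bxi _ (divr_gt0 a0 (ltr0n R 2)).
have rs0 : 0 < Num.min r s by rewrite lt_min r0.
have [n hn] := delta_ball_small q_pr X rs0.
have [eta seta etaxi] := step_approx n bxi.
have beta := step_currents_bounded R seta.
have dxi : (delta R xi eta < (Num.min r s)%:E)%E.
  by apply: hn => x v vn; rewrite etaxi.
have {}hr : Normc.normc (phi eta - phi xi) < a / 2.
  by apply: hr => //; apply: lt_le_trans dxi _; rewrite lee_fin ge_min lexx.
have {}hs : Normc.normc (psi eta - psi xi) < a / 2.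
  apply: hs => //; apply: lt_le_trans dxi _.
  by rewrite lee_fin ge_min lexx orbT.
have -> : phi xi - psi xi = - (phi eta - phi xi) + (psi eta - psi xi).
  by rewrite (e _ seta) opprB addrA subrK.
apply: le_trans (le_normcD _ _) _; rewrite normcN; lra.
Qed.

Theorem theorem8p2 (R : realType) (q : nat) (q_pr : prime q) (q_neq2 : q <> 2%N)
  (X : ptopologicalType) (X_compact : compact [set: X])
  (mu : {measure set (borel X) -> \bar R}) (mu_lt : (mu setT < (2^-1)%:E)%E)
  (* the K-invariant probability measure on the boundary *)
  (nu : probability (borel (boundary q_pr)) R) (nu_inv : K_invariant nu)
  (* the Steinberg representation on the completion Hq *)
  (Hq : lmodType R[i]) (ipq : {dot Hq for Num.conj})
  (iota : (boundary q_pr -> R[i]) -> Hq)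
  (Hq_def : is_steinberg_space nu ipq iota)
  (St : PGL2 (padic q_pr) -> {linear Hq -> Hq})
  (St_def : is_steinberg_rep ipq iota St)
  (* H^X = L^2(X, mu; Hq) *)
  (HX : lmodType R[i]) (ipX : {dot HX for Num.conj})
  (cls : (borel X -> Hq) -> HX) (HX_def : is_L2 mu ipq ipX cls)
  (* the symmetric Fock space over H^X and the representation Xi *)
  (E : lmodType R[i]) (ipE : {dot E for Num.conj}) (EXP : HX -> E)
  (E_def : is_fock ipX ipE EXP)
  (Xi : (X -> PGL2 (padic q_pr)) -> {linear E -> E})
  (Xi_def : is_fock_rep mu ipq iota St ipX cls ipE EXP Xi) :
  let phi (xi : X -> PGL2 (padic q_pr)) := ipE (Xi xi (EXP 0)) (EXP 0) in
  [/\ forall xi, step_currents xi ->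
        phi xi = (q%:R `^ (- 2^-1 *
          \int[mu]_x steinberg_sqnorm nu (bfun R (xi x))))%:C,
      positive_definite step_currents phi &
      exists Phi : (X -> PGL2 (padic q_pr)) -> R[i],
        [/\ forall xi, step_currents xi -> Phi xi = phi xi,
            delta_continuous (bounded_currents R) Phi,
            positive_definite (bounded_currents R) Phi &
            forall Psi : (X -> PGL2 (padic q_pr)) -> R[i],
              (forall xi, step_currents xi -> Psi xi = phi xi) ->
              delta_continuous (bounded_currents R) Psi ->
              forall xi, bounded_currents R xi -> Psi xi = Phi xi]].
Proof.
move=> phi.
have mu_fin : (mu setT < +oo)%E by exact: lt_trans mu_lt (ltry _).
have phiE xi : step_currents xi -> vacuum_form mu nu xi = phi xi.
  move=> sxi.
  by rewrite /phi (vacuum_coefficient mu_fin Hq_def HX_def E_def Xi_def).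
split.
- by move=> xi sxi; rewrite -phiE.
- by move=> n xi c; exact: (vacuum_positive_definite Xi_def).
exists (vacuum_form mu nu); split=> //.
- exact: vacuum_form_continuous.
- move=> n xi c.
  exact: (vacuum_form_positive_definite mu_fin Hq_def HX_def E_def Xi_def).
move=> Psi Psi_step cPsi; apply: delta_continuous_eq => //.
  exact: vacuum_form_continuous.
by move=> xi sxi; rewrite Psi_step // phiE.
Qed.
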